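(* Let $m,n\ge 1$ be integers, $d=m+n$, $p\in[1,\infty]$, and let $S$ be a nonempty open subset of the unit sphere in $\mathbb{R}^m$. Let $K(B;Q)$ and $\gamma_{(B;Q)}(\mathbf v)$ be as defined in the context (with respect to $m,n,p,S$). Suppose $f:\mathbb{R}_{>0}\to\mathbb{R}_{>0}$ is an increasing function such that $$\sum_{k=1}^\infty \frac{1}{f(k)}<\infty .$$ Then the following statements hold. (a) For almost every real $m\times n$ matrix $B$, and all sufficiently large $Q>0$, $$\sup_{\mathbf v\in K(B;Q)}\gamma_{(B;Q)}(\mathbf v)\;\le\;\sup_{\mathbf v\in\mathbb{R}^m}\gamma_{(B;Q)}(\mathbf v)\;<\;Q^{-\frac1m}\left(f(\log Q)\right)^{\frac1m}.$$ (b) If we further assume that $f(x)$ grows at most polynomially in $x$, then also, for almost every real $m\times n$ matrix $B$ and all sufficiently large $Q>0$, $$Q^{-\frac1m}\left(f(\log Q)\right)^{-\frac1{m^2}}\;<\;\sup_{\mathbf v\in\mathbb{R}^m}\gamma_{(B;Q)}(\mathbf v).$$ (c) Under the assumptions on $f$ of (a) and (b) (that is, $f$ is increasing, $\sum_k 1/f(k)<\infty$, and $f$ grows at most polynomially), for almost every real $m\times n$ matrix $B$ and all sufficiently large $Q>0$, $$Q^{-\frac1m}\left(f(\log Q)\right)^{-\frac1m}\;<\;\inf_{\mathbf v\in K(B;Q)}\gamma_{(B;Q)}(\mathbf v).$$ If in addition $S\cup(-S)$ is the entire unit sphere of $\mathbb{R}^m$, then there is a constant $C>0$ depending only on $d$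 and $p$ such that, for almost every real $m\times n$ matrix $B$ and all sufficiently large $Q>0$, $$\inf_{\mathbf v\in K(B;Q)}\gamma_{(B;Q)}(\mathbf v)\;\le\; C\,Q^{-\frac1m}.$$
   Context: For a real $m\times n$ matrix $B$ and a real number $Q>0$, write $$K(B;Q)=\{B\mathbf k \ (\mathrm{mod}\ 1):\ \mathbf k\in\mathbb{Z}^n\cap(0,Q^{1/n}]^n\}\subseteq \mathbb{R}^m/\mathbb{Z}^m .$$ Let $\mathrm{cone}(S)=\{c\mathbf u:\ \mathbf u\in S,\ c>0\}$; in particular $\mathbf 0\notin\mathrm{cone}(S)$. For $T\subseteq\mathbb{R}^m$, write $${\inf}_p^S\,T:=\inf\{\|\mathbf y\|_p:\ \mathbf y\in T\cap\mathrm{cone}(S)\},$$ where $\|\cdot\|_p$ is the $L^p$-norm on $\mathbb{R}^m$ and $\inf\emptyset=\infty$. For $\mathbf v\in\mathbb{R}^m$, define $$\gamma_{(B;Q)}(\mathbf v)={\inf}_p^S\{B\mathbf n+\mathbf m-\mathbf v\in\mathbb{R}^m:\ (\mathbf n,\mathbf m)\in\mathbb{Z}^n\times\mathbb{Z}^m,\ \mathbf n\in(0,Q^{1/n}]^n\}.$$ This depends only on $\mathbf v$ modulo $\mathbb{Z}^m$, so it is also defined for $\mathbf v\in K(B;Q)$. ''Almost every'' is with respect to Lebesgue measure on the space $\mathbb{R}^{m\times n}$ of real $m\times n$ matrices. ''All sufficiently large $Q$'' means all $Q\ge Q_0$ for some threshold $Q_0$ that may depend on $B$ and on the fixed data $m,n,p,S,f$.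 ''$f$ grows at most polynomially'' means that there is $k>0$ with $f(x)<x^k$ for all sufficiently large $x$. *)

(* Defs.v *)
From HB Require Import structures.
From mathcomp Require Import all_boot all_order all_algebra.
From mathcomp Require Import all_classical all_reals all_analysis.

Set Implicit Arguments.
Unset Strict Implicit.
Unset Printing Implicit Defensive.

Import Order.TTheory GRing.Theory Num.Theory.
Import numFieldNormedType.Exports.

Local Open Scope classical_set_scope.
Local Open Scope ring_scope.

(* Lebesgue measure on the space of real m x n matrices: Caratheodory's measure
   for the outer measure obtained from countable covers by half-open boxes. *)
Section lebesgue_matrix.
Context (R : realType) (m n : nat).
Local Open Scope ereal_scope.

Definition mx_box (a b : 'M[R]_(m, n)) : set 'M[R]_(m, n) :=
  [set B | forall i j, (a i j < B i j <= b i j)%R].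

Definition mx_box_volume (a b : 'M[R]_(m, n)) : \bar R :=
  (\prod_i \prod_j Num.max 0 (b i j - a i j))%R%:E.

(* The index set D may be finite or empty; the latter gives the empty set
   outer measure 0 even if m * n = 0. *)
Definition lebesgue_mx_outer (X : set 'M[R]_(m, n)) : \bar R :=
  ereal_inf [set c | exists (D : set nat) (a b : nat -> 'M[R]_(m, n)),
    X `<=` \bigcup_(k in D) mx_box (a k) (b k) /\
    c = \esum_(k in D) mx_box_volume (a k) (b k)].

Let volume_ge0 a b : 0 <= mx_box_volume a b.
Proof.
rewrite lee_fin; apply: prodr_ge0 => i _; apply: prodr_ge0 => j _.
by rewrite le_max lexx.
Qed.

Let outer_ge0 X : 0 <= lebesgue_mx_outer X.
Proof.
apply: le_ereal_inf_tmp => _ [D [a [b [_ ->]]]].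
by apply: esum_ge0 => k _; exact: volume_ge0.
Qed.

Let outer0 : lebesgue_mx_outer set0 = 0.
Proof.
apply/eqP; rewrite eq_le outer_ge0 andbT.
apply: ereal_inf_lbound; exists set0, (fun=> 0%R), (fun=> 0%R).
by rewrite esum_set0; split => //; exact: sub0set.
Qed.

Let le_outer : {homo lebesgue_mx_outer : X Y / X `<=` Y >-> X <= Y}.
Proof.
move=> X Y XY; apply/ereal_inf_le_tmp => c [D [a [b [YD ->]]]].
by exists D, a, b; split => //; exact: subset_trans YD.
Qed.

Let outer_sigma_subadditive : sigma_subadditive lebesgue_mx_outer.
Proof.
move=> A; have [[i ioo]|] := pselect (exists i, lebesgue_mx_outer (A i) = +oo).
  rewrite (eseries_pinfty _ _ ioo) ?leey// => k _.
  by rewrite -ltNye (lt_le_trans _ (outer_ge0 _)).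
rewrite -forallNE => Aoo.
apply/lee_addgt0Pr => e e0.
rewrite (le_trans _ (epsilon_trick _ _ (ltW e0)))//.
pose P k (G : set nat * (nat -> 'M[R]_(m, n)) * (nat -> 'M[R]_(m, n))) :=
  A k `<=` \bigcup_(l in G.1.1) mx_box (G.1.2 l) (G.2 l) /\
  \esum_(l in G.1.1) mx_box_volume (G.1.2 l) (G.2 l)
    <= lebesgue_mx_outer (A k) + (e / (2 ^ k.+1)%:R)%:E.
have [G PG] : {G : _ & forall k, P k (G k)}.
  apply: (@choice _ _ P) => k; rewrite /P.
  have Af : lebesgue_mx_outer (A k) \is a fin_num.
    rewrite fin_numE; apply/andP; split; last exact/eqP.
    by rewrite -ltNye (lt_le_trans _ (outer_ge0 _)).
  have ek : (0 < e / (2 ^ k.+1)%:R)%R by rewrite divr_gt0// ltr0n expn_gt0.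
  have [_ [D [a [b [AD ->]]]] Dk] := lb_ereal_inf_adherent ek Af.
  by exists (D, a, b); split => //; exact: ltW.
have /card_esym/ppcard_eqP[f] := card_nat2.
pose v k l := mx_box_volume ((G k).1.2 l) ((G k).2 l).
pose D k := (G k).1.1.
apply: (@le_trans _ _ (\esum_(p in setT `*`` D) v p.1 p.2)).
  apply: ereal_inf_lbound.
  exists [set t | D (f t).1 (f t).2],
    (fun t => (G (f t).1).1.2 (f t).2), (fun t => (G (f t).1).2 (f t).2).
  split.
    move=> B [k _ /(PG k).1[l Dl Bl]].
    by exists (f^-1%FUN (k, l)); rewrite /= invK ?inE.
  apply: (@reindex_esum R _ _ _ _ f); split.
  - by move=> t Dt; split.
  - by move=> t u _ _; apply: inj; rewrite inE.
  - by move=> [k l] [_ Dkl]; exists (f^-1%FUN (k, l)); rewrite /= invK ?inE.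
rewrite -(@esum_esum R _ _ setT D v); last by move=> k l _ _; exact: volume_ge0.
rewrite -nneseries_esumT; last first.
  by move=> k; apply: esum_ge0 => l _; exact: volume_ge0.
apply: lee_nneseries => [k _ _|k _]; last exact: (PG k).2.
by apply: esum_ge0 => l _; exact: volume_ge0.
Qed.

HB.instance Definition _ := isOuterMeasure.Build R _ lebesgue_mx_outer
  outer0 outer_ge0 le_outer outer_sigma_subadditive.

Definition lebesgue_mx :
    set (caratheodory_type lebesgue_mx_outer) -> \bar R :=
  lebesgue_mx_outer.

HB.instance Definition _ := Measure.copy lebesgue_mx
  ((lebesgue_mx_outer : {outer_measure set _ -> \bar R})
    : set (caratheodory_type lebesgue_mx_outer) -> \bar R).

Lemma lebesgue_mx_negligibleP (N : set (caratheodory_type lebesgue_mx_outer)) :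
  lebesgue_mx.-negligible N <-> lebesgue_mx_outer N = 0.
Proof.
split=> [[A [_ A0 NA]]|N0].
  by apply/eqP; rewrite eq_le outer_ge0 andbT -A0; exact: le_outer_measure.
exists N; split => //; apply: le_caratheodory_measurable => X.
rewrite [Y in Y + _](_ : _ = 0); last first.
  apply/eqP; rewrite eq_le outer_ge0 andbT -N0.
  by apply: le_outer_measure; exact: subIsetr.
by rewrite add0e; apply: le_outer_measure; exact: subIsetl.
Qed.

End lebesgue_matrix.
Arguments lebesgue_mx R m n : clear implicits.

Definition lp_norm (R : realType) (m : nat) (p : \bar R) (y : 'cV[R]_m) : R :=
  match p with
  | r%:E => (\sum_i `|y i 0| `^ r) `^ r^-1
  | +oo%E => \big[Num.max/0]_i `|y i 0|
  | -oo%E => 0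
  end.

Definition unit_sphere (R : realType) (m : nat) : set 'cV[R]_m :=
  [set u | lp_norm 2%:E u = 1].
Arguments unit_sphere R m : clear implicits.

Definition open_in_sphere (R : realType) (m : nat) (S : set 'cV[R]_m) : Prop :=
  exists2 U : set 'cV[R]_m, open U & S = U `&` unit_sphere R m.

Section gaps.
Context (R : realType) (m n : nat).
Implicit Types (S T : set 'cV[R]_m) (B : 'M[R]_(m, n)) (Q : R) (v : 'cV[R]_m).

Definition cone S : set 'cV[R]_m :=
  [set y | exists c u, [/\ 0 < c, S u & y = c *: u]].

Definition inf_norm (p : \bar R) S T : \bar R :=
  ereal_inf [set (lp_norm p y)%:E | y in T `&` cone S].

(* Z^n `&` (0, Q^(1/n)]^n *)
Definition int_box Q : set 'cV[int]_n :=
  [set k | forall i, 0 < ((k i 0)%:~R : R) <= Q `^ n%:R^-1].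

(* The subset K(B;Q) of the torus R^m / Z^m is represented by its inverse image
   in R^m. *)
Definition K B Q : set 'cV[R]_m :=
  [set w | exists (k : 'cV[int]_n) (l : 'cV[int]_m),
    int_box Q k /\ w = B *m map_mx intr k + map_mx intr l].

Definition gamma (p : \bar R) S B Q v : \bar R :=
  inf_norm p S [set y | exists (k : 'cV[int]_n) (l : 'cV[int]_m),
    int_box Q k /\ y = B *m map_mx intr k + map_mx intr l - v].

Lemma gammaDz p S B Q v (l : 'cV[int]_m) :
  gamma p S B Q (v + map_mx intr l) = gamma p S B Q v.
Proof.
congr (inf_norm p S _); apply/seteqP; split => y [k [l' [Qk ->]]].
  exists k, (l' - l); split => //.
  by rewrite map_mxB opprD !addrA addrAC.
exists k, (l' + l); split => //.
by rewrite map_mxD opprD !addrA [RHS]addrAC addrK.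
Qed.

End gaps.

Definition poly_growth (R : realType) (f : R -> R) : Prop :=
  exists2 k : R, 0 < k & \forall x \near +oo, f x < x `^ k.

(* Main.v *)
Require Import Defs.
From mathcomp Require Import all_boot all_order all_algebra.
From mathcomp Require Import all_classical all_reals all_analysis.
From mathcomp Require Import ring lra zify.

Set Implicit Arguments.
Unset Strict Implicit.
Unset Printing Implicit Defensive.

Import Order.TTheory GRing.Theory Num.Theory.
Import numFieldNormedType.Exports.

(** The gaps of [K B Q] are governed by two questions about the points
    [B *m k + l] with [l] integral and [k] integral in [(0, x]^n, [x = Q^(1/n)]:
    how well they cover [R^m], and how well they are separated. Up to constants
    both questions have the answer [Q^(-1/m)], and the factors [f(ln Q)] measure
    the deviations that occur for almost every [B]. For each natural number [j]
    the scales [Q] with [j <= ln Q < j + 1] are treated together. At these scales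
    the desired covering or separation fails for a proportion [O((f j)^-1)] of
    the matrices in each unit cube, and the convergence of the sum of the
    [(f j)^-1] is exactly what Borel-Cantelli needs ([ae_eventually_notin]).

    Separation ([outer_small_value]). For an integer vector [h != 0] and a random
    [B], the vector [B *m h] is uniformly distributed modulo [Z^m]. A union bound
    over [|h| <= x] shows that some [B *m h] is within [delta] of [Z^m] with
    probability [O(x^n delta^m)]. Differences of points of [K B Q] are of this
    form, which gives the lower bound for the infimum.

    Covering ([outer_uncovered]). This is a second moment argument. Thicken the
    points [B *m s], [s] in [{0..H-1}^n] with [H ~ x / 2], to cubes of side about
    [eps]. As [B *m s - B *m t] is uniform for [s != t], these cubes overlap on
    average no more than independent random cubes, apart from the diagonal
    [s = t]. By Cauchy-Schwarz they cover more than half of the torus, except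
    with probability [O(1 / (x^n eps^m))]. A subset [E] of more than half of a
    finite group satisfies [E - E = G], so that every [w] is within [eps] of some
    [B *m (s - t)] modulo [Z^m], and [s - t] can be translated into [(0, x]^n.
    The cone over an open set of directions contains balls of radius
    proportional to the distance of their centre from [0] ([open_cone_ball]).
    Covering by such balls bounds the gaps in the directions of [S].

    Both probabilities are computed by finite counting: for a large prime [p] the
    matrix [B] is replaced by the residue mod [p] of the integer part of [p *: B],
    a uniformly random matrix over ['F_p], for which [A *m h] is exactly uniform
    ([card_mulmx_fiber]).

    The other two bounds are pigeonhole arguments. At most [Q] balls whose radius
    is much smaller than [Q^(-1/m)] do not cover the torus ([covering_count]), and
    [f] tends to infinity; this gives the lower bound for the supremum. Two points
    of [K B Q] are within a constant times [Q^(-1/m)] of each other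
    ([pigeonhole_approx]), and their difference or its opposite points into the
    cone when [S] and [- S] cover the sphere. *)

Local Open Scope ring_scope.

(** * Counting matrices over a finite field *)

Section FiniteCounting.
Import mathcomp.boot.fintype mathcomp.boot.finset.

(** Cauchy-Schwarz against the constant 1, in the naturals. *)
Lemma sqr_sum_leq (T : finType) (P : pred T) (a : T -> nat) :
  ((\sum_(x | P x) a x) ^ 2 <= #|P| * \sum_(x | P x) a x ^ 2)%N.
Proof.
rewrite -(leq_pmul2l (ltn0Sn 1)) -mulnn big_distrlr/=.
have -> : (2 * (#|P| * \sum_(x | P x) a x ^ 2) =
    \sum_(x | P x) \sum_(y | P y) (a x ^ 2 + a y ^ 2))%N.
  rewrite [RHS](eq_bigr (fun x => #|P| * a x ^ 2 + \sum_(y | P y) a y ^ 2)%N).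
    by rewrite big_split/= sum_nat_const -big_distrr/= mul2n addnn.
  by move=> x _; rewrite big_split/= sum_nat_const.
rewrite big_distrr/=; apply: leq_sum => x _; rewrite big_distrr/=.
by apply: leq_sum => y _; exact: nat_Cauchy.
Qed.

(** [E] and [E + w] are too large to be disjoint. *)
Lemma large_set_differences (V : finZmodType) (E : {set V}) (w : V) :
  (#|V| < 2 * #|E|)%N -> exists x y, [/\ x \in E, y \in E & x - y = w].
Proof.
move=> big_E; have /set0Pn[x] : E :&: [set y + w | y in E] != set0.
  apply: contraTneq big_E => E0; rewrite -leqNgt mul2n -addnn.
  by rewrite -{2}(card_imset E (@addIr _ w)) -cardsUI E0 cards0 addn0 max_card.
rewrite inE => /andP[xE /imsetP[y yE xy]].
by exists x, y; split; rewrite // xy addrAC subrr add0r.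
Qed.

(** Counts the coincidences [phi x i = phi x j] pair by pair, so that each pair
    can be bounded separately. *)
Lemma exchange_coincidences (X Y : finType) (Z : eqType) (D : {set Y})
    (phi : X -> Y -> Z) :
  (\sum_x \sum_(i in D) \sum_(j in D) (phi x i == phi x j) =
   \sum_(i in D) \sum_(j in D) #|[set x | phi x i == phi x j]|)%N.
Proof.
rewrite exchange_big/=; apply: eq_bigr => i _.
rewrite exchange_big; apply: eq_bigr => j _.
rewrite -sum1_card [RHS]big_mkcond/=; apply: eq_bigr => x _.
by rewrite inE; case: (_ == _).
Qed.

Section FiniteField.
Variable F : finFieldType.

(** For a uniformly random matrix [A] and a fixed [h != 0], the vector [A *m h]
    is uniformly distributed: [A |-> A *m h] is a surjective homomorphism, so its
    fibres are translates of one another. *)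
Lemma card_mulmx_fiber m n (h : 'cV[F]_n) (c : 'cV[F]_m) : h != 0 ->
  (#|[set A : 'M[F]_(m, n) | A *m h == c]| * #|F| ^ m = #|F| ^ (m * n))%N.
Proof.
move=> h0; pose Z d := [set A : 'M[F]_(m, n) | A *m h == d].
have [j hj] : exists j, h j 0 != 0.
  apply/existsP; rewrite -negb_forall; apply: contra h0 => /forallP h0.
  apply/eqP/colP => j; rewrite mxE; exact/eqP.
have surj d : exists A : 'M[F]_(m, n), A *m h = d.
  exists (\matrix_(i, k) (if k == j then d i 0 / h j 0 else 0)).
  apply/colP => i; rewrite mxE (bigD1 j)//= big1 => [|k kj].
    by rewrite mxE eqxx addr0 divfK.
  by rewrite mxE (negbTE kj) mul0r.
have cardZ d : #|Z d| = #|Z c|.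
  have [A Ah] := surj (c - d).
  rewrite -(card_imset (Z d) (@addIr _ A)); apply: eq_card => X.
  apply/imsetP/idP => [[Y]|]; rewrite !inE.
    by move=> /eqP Yd ->; rewrite mulmxDl Yd Ah subrKC.
  move=> /eqP Xc; exists (X - A); rewrite ?subrK// inE mulmxBl Xc Ah.
  by rewrite subKr.
rewrite -(card_mx F m n) -[RHS]sum1_card.
rewrite (partition_big (fun A : 'M[F]_(m, n) => A *m h) xpredT)//=.
rewrite (eq_bigr (fun=> #|Z c|)); last first.
  by move=> d _; rewrite -(cardZ d) -sum1_card; apply: eq_bigl => A; rewrite inE.
by rewrite sum_nat_const mulnC card_mx muln1.
Qed.

(** The union bound over [T] and [I], with [card_mulmx_fiber] for each pair. *)
Lemma card_mulmx_hits m n (T : {set 'cV[F]_n}) (I : {set 'cV[F]_m}) :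
  0 \notin T ->
  (#|[set A : 'M[F]_(m, n) | [exists h in T, A *m h \in I]]| * #|F| ^ m
   <= #|T| * #|I| * #|F| ^ (m * n))%N.
Proof.
move=> T0.
have sub : [set A : 'M[F]_(m, n) | [exists h in T, A *m h \in I]] \subset
    \bigcup_(hc in setX T I) [set A : 'M[F]_(m, n) | A *m hc.1 == hc.2].
  apply/subsetP => A; rewrite inE => /existsP[h /andP[hT Ah]].
  by apply/bigcupP; exists (h, A *m h); rewrite ?inE/= ?hT ?eqxx.
apply: (leq_trans (leq_mul (subset_leq_card sub) (leqnn _))).
apply: (@leq_trans ((\sum_(hc in setX T I)
    #|[set A : 'M[F]_(m, n) | A *m hc.1 == hc.2]|) * #|F| ^ m)).
  rewrite leq_mul2r; apply/orP; right.
  elim/big_ind2: _ => [|a X b Y Xa Yb|hc _]//; first by rewrite cards0.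
  by rewrite (leq_trans (leq_card_setU X Y).1) ?leq_add.
rewrite big_distrl/= -cardsX -sum_nat_const leq_sum// => -[h c].
rewrite inE/= => /andP[hT _]; rewrite card_mulmx_fiber//.
by apply: contraNneq T0 => <-.
Qed.

Section SecondMoment.
Variables (m n : nat) (T : {set 'cV[F]_n}) (I : {set 'cV[F]_m}).
Implicit Types (A : 'M[F]_(m, n)).

Let hits A (x : 'cV[F]_m) :=
  #|[set si in setX T I | A *m si.1 + si.2 == x]|.

Let sum_hits A : (\sum_x hits A x = #|T| * #|I|)%N.
Proof.
rewrite -cardsX -sum1_card (partition_big (fun si => A *m si.1 + si.2) xpredT)//=.
by apply: eq_bigr => x _; rewrite sum1_card; apply: eq_card => si; rewrite inE.
Qed.

Let sum_hits_sqr A : (\sum_x hits A x ^ 2 =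
  \sum_(si in setX T I) \sum_(tj in setX T I)
    (A *m si.1 + si.2 == A *m tj.1 + tj.2)%R)%N.
Proof.
rewrite [RHS](partition_big (fun si => A *m si.1 + si.2) xpredT)//=.
apply: eq_bigr => x _; rewrite -mulnn {1}/hits -sum1_card big_distrl/=.
apply: eq_big => [si|si]; rewrite !inE// => /andP[_ /eqP Asi].
rewrite mul1n Asi /hits -sum1_card big_mkcond/= [RHS]big_mkcond/=.
apply: eq_bigr => tj _; rewrite !inE eq_sym.
by do 3 case: (_ \in _) || case: (_ == _).
Qed.

(* Off the diagonal, pairs with the same first component never meet and the
   others meet for a proportion [|F|^-m] of the matrices. *)
Let sum_pairs : (#|F| ^ m *
  \sum_A \sum_(si in setX T I) \sum_(tj in setX T I)
    (A *m si.1 + si.2 == A *m tj.1 + tj.2)%R <=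
  (#|F| ^ m * (#|T| * #|I|) + (#|T| * #|I|) ^ 2) * #|F| ^ (m * n))%N.
Proof.
rewrite (exchange_coincidences _ (fun A si => A *m si.1 + si.2)).
have pair (si tj : 'cV[F]_n * 'cV[F]_m) :
  (#|F| ^ m *
     #|[set A : 'M[F]_(m, n) | (A *m si.1 + si.2 == A *m tj.1 + tj.2)%R]|
   <= (#|F| ^ m * (tj == si) + 1) * #|F| ^ (m * n))%N.
  have [->|tsi] := eqVneq tj si.
    rewrite muln1 (leq_trans _ (leq_mul (leq_addr 1 _) (leqnn _)))//.
    by rewrite leq_mul2l -card_mx max_card orbT.
  rewrite muln0 mul1n mulnC; have [ts|ts] := eqVneq tj.1 si.1.
    rewrite (_ : [set A | _] = set0) ?cards0//; apply/setP => A.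
    rewrite !inE ts; apply/negbTE; rewrite (inj_eq (addrI _)).
    by apply: contra tsi => /eqP e; rewrite [tj]surjective_pairing -e ts
      -surjective_pairing.
  rewrite -(@card_mulmx_fiber m n (si.1 - tj.1) (tj.2 - si.2)); last first.
    by rewrite subr_eq0 eq_sym.
  rewrite leq_mul2r; apply/orP; right; apply: subset_leq_card.
  apply/subsetP => A; rewrite !inE mulmxBr => /eqP e.
  by rewrite subr_eq addrAC [tj.2 + _]addrC -e addrK.
rewrite big_distrr/= -cardsX.
apply: (@leq_trans (\sum_(si in setX T I) \sum_(tj in setX T I)
   (#|F| ^ m * (tj == si) + 1) * #|F| ^ (m * n))%N).
  by apply: leq_sum => si _; rewrite big_distrr/=; exact: leq_sum.
rewrite (eq_bigr (fun=> (#|F| ^ m + #|setX T I|) * #|F| ^ (m * n))%N); last first.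
  move=> si siTI; rewrite -big_distrl/= big_split/= sum1_card -big_distrr/=.
  by rewrite (bigD1 si)//= eqxx big1 ?addn0 ?muln1// => tj /andP[_ /negbTE ->].
by rewrite sum_nat_const mulnA mulnDr -mulnn [(#|F| ^ m * _)%N]mulnC.
Qed.

(** If [w] is not of the form [A *m (s - t) + (i - j)], then [w] is not a
    difference of two points of [A *m T + I], so this set has at most half of
    the points of [F^m] ([large_set_differences]). By Cauchy-Schwarz the number of
    coincidences among the points [A *m s + i] is then at least twice its
    least possible value [(|T| |I|)^2 / |F|^m]. The mean number of coincidences
    exceeds that value by at most the diagonal contribution [|T| |I|], which
    leaves room for few such [A]. *)
Lemma card_uncovering :
  (#|[set A : 'M[F]_(m, n) | [exists w, [forall s in T, forall t in T,
      forall i in I, forall j in I, (A *m (s - t) + (i - j) != w)%R]]]|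
    * (#|T| * #|I|) <= #|F| ^ m * #|F| ^ (m * n))%N.
Proof.
set Bad := [set A | _]; set P := (#|T| * #|I|)%N.
pose E A := [set x | (0 < hits A x)%N].
have badE A : A \in Bad -> (2 * #|E A| <= #|F| ^ m)%N.
  rewrite inE => /existsP[w /'forall_in_forall_inP bad].
  rewrite leqNgt -[X in (_ ^ X)%N]muln1 -card_mx; apply/negP => /(large_set_differences w).
  move=> [x [y]]; rewrite !inE => -[/card_gt0P[[s i]] + /card_gt0P[[t j]] +].
  rewrite !inE/= => /andP[/andP[sT iI] /eqP <-] /andP[/andP[tT jI] /eqP <-] st.
  have /'forall_in_forall_inP/(_ i iI j jI)/eqP := bad s sT t tT; apply.
  by rewrite -st mulmxBr opprD addrACA.
(* A bad [A] gains a factor 2 over the general Cauchy-Schwarz bound. *)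
have sqrP A : (P ^ 2 * (1 + (A \in Bad)) <= #|F| ^ m * \sum_x hits A x ^ 2)%N.
  apply: (@leq_trans ((1 + (A \in Bad)) * #|E A| * \sum_x hits A x ^ 2)); last first.
    rewrite leq_mul2r; apply/orP; right; case: (boolP (A \in Bad)) => [/badE//|_].
    by rewrite mul1n -[X in (_ ^ X)%N]muln1 -card_mx max_card.
  rewrite mulnC -mulnA leq_mul2l/= /P -(sum_hits A).
  rewrite (bigID (mem (E A)))/= [X in (_ + X)%N]big1 ?addn0; last first.
    by move=> x; rewrite inE lt0n negbK => /eqP.
  apply: (leq_trans (sqr_sum_leq _ _)); rewrite leq_mul2l; apply/orP; right.
  by rewrite [leqRHS](bigID (mem (E A)))/= leq_addr.
have : (P ^ 2 * (#|F| ^ (m * n) + #|Bad|)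
    <= (#|F| ^ m * P + P ^ 2) * #|F| ^ (m * n))%N.
  apply: leq_trans sum_pairs; rewrite big_distrr/=.
  apply: (@leq_trans (\sum_A P ^ 2 * (1 + (A \in Bad)))).
    by rewrite -big_distrr/= big_split/= sum1_card card_mx -big_mkcond/= sum1_card.
  by apply: leq_sum => A _; rewrite -sum_hits_sqr.
have [->|P0 le] := posnP P; first by rewrite !muln0.
rewrite -(leq_pmul2l P0) -(leq_add2r (P ^ 2 * #|F| ^ (m * n))).
move: le; rewrite -mulnn; congr (_ <= _)%N; ring.
Qed.

End SecondMoment.
End FiniteField.
End FiniteCounting.

Local Open Scope classical_set_scope.

(** * Covering sets of matrices by boxes of side 1/p *)

Section ResidueBoxes.
Variable p : nat.

Definition residue_box n N : {set 'cV['F_p]_n} :=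
  [set \col_i (v i 0)%:R | v : 'cV['I_N]_n]%SET.

Lemma mem_residue_box n N (h : 'cV[int]_n) :
  (forall i, 0 <= h i 0 < N%:Z) -> map_mx intr h \in residue_box n N.
Proof.
move=> hN; have hlt i : (absz (h i 0%R) < N)%N by have := hN i; lia.
apply/imsetP; exists (\col_i Ordinal (hlt i)); rewrite ?inE//.
apply/colP => i; rewrite !mxE/= pmulrn; congr (_%:~R).
by have := hN i; lia.
Qed.

Lemma residue_box_int n N (u : 'cV['F_p]_n) : u \in residue_box n N ->
  exists2 h : 'cV[int]_n, (forall i, 0 <= h i 0 < N%:Z) & u = map_mx intr h.
Proof.
move=> /imsetP[v _ ->]; exists (\col_i (v i 0 : nat)%:Z).
  by move=> i; rewrite mxE; have := ltn_ord (v i 0); lia.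
by apply/colP => i; rewrite !mxE.
Qed.

Lemma card_residue_box_le n N : (#|residue_box n N| <= N ^ n)%N.
Proof.
apply: (leq_trans (leq_imset_card _ _)).
by rewrite card_mx card_ord muln1.
Qed.

Definition sym_residue_box n N : {set 'cV['F_p]_n} :=
  [set h - const_mx N%:R | h in residue_box n N.*2.+1]%SET.

Lemma mem_sym_residue_box n N (h : 'cV[int]_n) :
  (forall i, - N%:Z <= h i 0 <= N%:Z) -> map_mx intr h \in sym_residue_box n N.
Proof.
move=> hN; apply/imsetP; exists (map_mx intr (h + const_mx N%:Z)).
  by apply: mem_residue_box => i; rewrite !mxE; move: (h i 0) (hN i) => a; lia.
by rewrite map_mxD map_const_mx addrK.
Qed.

Lemma card_sym_residue_box_le n N : (#|sym_residue_box n N| <= N.*2.+1 ^ n)%N.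
Proof. by rewrite (leq_trans (leq_imset_card _ _)) ?card_residue_box_le. Qed.

Hypothesis p_prime : prime p.

Lemma card_residue_box n N : (N <= p)%N -> #|residue_box n N| = (N ^ n)%N.
Proof.
move=> Np; rewrite card_imset ?card_mx ?card_ord ?muln1// => u v.
move=> /colP uv; apply/colP => i; apply/val_inj.
have /(congr1 val) := uv i; rewrite !mxE /= !val_Fp_nat// !modn_small//.
  by rewrite (leq_trans _ Np).
by rewrite (leq_trans _ Np).
Qed.

Lemma nat_intr_Fp (a : int) k : (k < p)%N ->
  (((p%:Z * a + k%:Z)%:~R : 'F_p) : nat) = k.
Proof.
move=> kp; suff -> : (p%:Z * a + k%:Z)%:~R = k%:R :> 'F_p.
  by rewrite val_Fp_nat// modn_small.
have p0 : p%:Z%:~R = 0 :> 'F_p by exact: pchar_Fp_0.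
by rewrite intrD intrM p0 mul0r add0r.
Qed.

Lemma intr_Fp_eq0 (a : int) : (a%:~R = 0 :> 'F_p) -> exists b, a = p%:Z * b.
Proof.
move=> /eqP; rewrite -(dvdz_pcharf (pchar_Fp p_prime)) => /dvdzP[b ->].
by exists b; rewrite mulrC.
Qed.

Lemma map_intr_Fp_eq0 m n (u : 'M[int]_(m, n)) :
  map_mx intr u = 0 :> 'M['F_p]_(m, n) -> exists v, u = p%:Z *: v.
Proof.
move=> /matrixP u0; have /(_ _ _)/cid uE i j : exists b, u i j = p%:Z * b.
  by apply: intr_Fp_eq0; have := u0 i j; rewrite !mxE.
by exists (\matrix_(i, j) sval (uE i j)); apply/matrixP => i j;
  rewrite !mxE; exact: svalP (uE i j).
Qed.

Lemma map_intr_Fp_scale m n (v : 'M[int]_(m, n)) :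
  map_mx intr (p%:Z *: v) = 0 :> 'M['F_p]_(m, n).
Proof.
apply/matrixP => i j; rewrite !mxE intrM.
have -> : p%:Z%:~R = 0 :> 'F_p by exact: pchar_Fp_0.
by rewrite mul0r.
Qed.

End ResidueBoxes.

Section Cells.
Variables (R : realType) (m n : nat).
Implicit Types (B : 'M[R]_(m, n)) (z : 'M[int]_(m, n)).

(** The box of side [1 / p] around [B], half-open on the left as in [mx_box], is
    indexed by its lower corner multiplied by [p]. *)
Definition cell (p : nat) B : 'M[int]_(m, n) :=
  map_mx (fun x => Num.ceil (p%:R * x) - 1) B.

Lemma cell_itv p B i j :
  ((cell p B i j)%:~R < p%:R * B i j <= (cell p B i j)%:~R + 1).
Proof.
by have := ceil_itv (p%:R * B i j); rewrite mxE; move: (Num.ceil _) => c; lra.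
Qed.

Definition unit_cube z : set 'M[R]_(m, n) :=
  [set B | forall i j, (z i j)%:~R < B i j <= (z i j)%:~R + 1].

(** Each residue matrix mod [p] is the residue of exactly one cell inside a given
    unit cube, so the outer measure is at most the proportion of the residues in
    [Z]. This turns bounds on Lebesgue measure into counting over ['F_p]. *)
Lemma outer_cells_le p (p_prime : prime p) z (Z : {set 'M['F_p]_(m, n)}) :
  (lebesgue_mx_outer (unit_cube z `&` [set B | map_mx intr (cell p B) \in Z])
   <= (#|Z|%:R / p%:R ^+ (m * n))%:E)%E.
Proof.
have p0 : (0 : R) < p%:R by rewrite ltr0n prime_gt0.
pose a k : 'M[R]_(m, n) := \matrix_(i, j)
  ((z i j)%:~R + (nth 0 (enum Z) k i j : nat)%:R / p%:R).
apply: (@le_trans _ _ (\esum_(k in `I_#|Z|)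
    mx_box_volume (a k) (a k + const_mx p%:R^-1))).
  apply: ereal_inf_lbound; exists `I_#|Z|, a, (fun k => a k + const_mx p%:R^-1).
  split=> // B [zB BZ].
  exists (index (map_mx intr (cell p B)) (enum Z)).
    by rewrite /= cardE index_mem mem_enum.
  move=> i j; rewrite !mxE nth_index ?mem_enum// !mxE.
  have := zB i j; have := cell_itv p B i j.
  rewrite mxE; move: (Num.ceil _ - 1) => c cB zBij.
  have [k kp ck] : exists2 k : nat, (k < p)%N & c = p%:Z * z i j + k%:Z.
    have : (p%:Z * z i j < c + 1) && (c < p%:Z * z i j + p%:Z).
      rewrite -!(ltr_int R) !rmorphD !rmorphM/= -!pmulrn; nra.
    by move=> c0; exists (absz (c - p%:Z * z i j)%R); lia.
  have -> : ((c%:~R : 'F_p) : nat) = k by rewrite ck nat_intr_Fp.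
  move: cB; rewrite ck rmorphD rmorphM/= -!pmulrn => cB.
  rewrite -(ltr_pM2l p0) -[X in _ && X](ler_pM2l p0) !mulrDr mulrCA divff ?gt_eqF//.
  by rewrite mulr1.
rewrite esum_fset; [|exact: finite_II|]; last first.
  move=> k _; rewrite lee_fin; apply: prodr_ge0 => i _; apply: prodr_ge0 => j _.
  by rewrite le_max lexx.
rewrite -(fsbig_ord _ _ (fun k => mx_box_volume (a k) (a k + const_mx p%:R^-1))).
rewrite (eq_bigr (fun=> (p%:R ^- (m * n))%:E)); last first.
  move=> k _; rewrite /mx_box_volume; congr (_%:E).
  rewrite (eq_bigr (fun=> p%:R ^- n)); last first.
    move=> i _; rewrite (eq_bigr (fun=> p%:R^-1)); last first.
      by move=> j _; rewrite !mxE addrAC subrr add0r max_r// invr_ge0 ltW.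
    by rewrite prodr_const card_ord exprVn.
  by rewrite prodr_const card_ord exprVn -exprM mulnC.
by rewrite sumEFin sumr_const card_ord lee_fin mulr_natl.
Qed.

End Cells.

(** * Measure of the matrices with bad separation or bad covering *)

Lemma norm_sub_box (N : nat) (a b : int) :
  0 <= a < N%:Z -> 0 <= b < N%:Z -> `|a - b| <= N%:Z.
Proof. by move=> aN bN; rewrite ler_norml; lia. Qed.

Lemma sub_add_box (N : nat) (a b : int) :
  0 <= a < N%:Z -> 0 <= b < N%:Z -> 0 < a - b + N%:Z <= N%:Z + N%:Z - 1.
Proof. lia. Qed.

Lemma small_multiple_eq0 (p N : nat) (a : int) :
  (N < p)%N -> - N%:Z <= p%:Z * a <= N%:Z -> a = 0.
Proof. by move=> Np /andP[Na aN]; nia. Qed.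

Section SupNorm.
Variable R : realType.

Lemma cV_norm_le m (y : 'cV[R]_m) (e : R) : 0 <= e ->
  (`|y| <= e) = [forall i, `|y i 0| <= e].
Proof.
move=> e0; rewrite [`|y|]mx_normrE; apply/idP/forallP => [le i|le].
  by apply: le_trans le; exact: (le_bigmax _ (fun ij => `|y ij.1 ij.2|) (i, 0)).
by apply/bigmax_leP; split=> // -[i j] _ /=; rewrite [j]ord1.
Qed.

Lemma cV_norm_coord m (y : 'cV[R]_m) i : `|y i 0| <= `|y|.
Proof. by have := cV_norm_le y (normr_ge0 y); rewrite lexx => /esym/forallP. Qed.

(** Replacing [p *: B] by its integer part moves [B *m k] by an amount that does
    not grow with [p], hence is negligible at scale [1 / p] for large [p]. *)
Lemma cell_mulmx_err m n p (B : 'M[R]_(m, n)) (k : 'cV[int]_n) (N : R) :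
  0 <= N -> (forall j, `|(k j 0)%:~R : R| <= N) ->
  `|p%:R *: (B *m map_mx intr k) - map_mx intr (cell p B *m k)| <= n%:R * N.
Proof.
move=> N0 kN; rewrite cV_norm_le ?mulr_ge0//; apply/forallP => i.
rewrite map_mxM scalemxAl -mulmxBl !mxE.
apply: (le_trans (ler_norm_sum _ _ _)); rewrite -[n in leRHS]card_ord mulr_natl.
rewrite -sumr_const; apply: ler_sum => j _.
rewrite !mxE normrM -[leRHS]mul1r ler_pM//.
have := ceil_itv (p%:R * B i j); move: (Num.ceil _) => c.
by rewrite ler_norml intrB; lra.
Qed.

Lemma norm_intr_le_trunc (x : R) (a : int) :
  `|a%:~R| <= x -> - (Num.trunc x)%:Z <= a <= (Num.trunc x)%:Z.
Proof.
move=> ax; rewrite -ler_norml -abszE lez_nat truncn_ge_nat ?(le_trans _ ax)//.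
by rewrite pmulrn abszE intr_norm.
Qed.

Lemma natr_le_primes (x : R) : exists2 p, prime p & x <= p%:R.
Proof.
have [p xp p_prime] := prime_above (Num.trunc x).
by exists p => //; rewrite (le_trans (ltW (truncnS_gt x)))// ler_nat.
Qed.

End SupNorm.

Section Measure.
Variables (R : realType) (m n : nat).
Implicit Types (B : 'M[R]_(m, n)) (z : 'M[int]_(m, n)).

Definition small_value (x delta : R) : set 'M[R]_(m, n) :=
  [set B | exists (h : 'cV[int]_n) (l : 'cV[int]_m),
    [/\ h != 0, forall j, `|(h j 0)%:~R : R| <= x &
        `|B *m map_mx intr h + map_mx intr l| <= delta] ].

Definition uncovered (x eps : R) : set 'M[R]_(m, n) :=
  [set B | exists w : 'cV[R]_m, forall (k : 'cV[int]_n) (l : 'cV[int]_m),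
    (forall j, 0 < ((k j 0)%:~R : R) <= x) ->
    eps < `|B *m map_mx intr k + map_mx intr l - w| ].

(** There are at most [(3 x)^n] vectors [h], and for each of them [B *m h] mod 1
    is uniformly distributed, hence within [delta] of [0] with probability
    [O(delta^m)]. *)
Lemma outer_small_value z (x delta : R) : 1 <= x -> 0 < delta ->
  (lebesgue_mx_outer (unit_cube z `&` small_value x delta)
   <= ((3 * x) ^+ n * (5 * delta) ^+ m)%:E)%E.
Proof.
move=> x1 d0; pose N := Num.trunc x.
have Nx : N%:R <= x by rewrite truncn_le; lra.
(* [p] is so large that the discretisation error is below [p * delta] and that
   no admissible [h] vanishes mod [p]. *)
have [p p_prime] := natr_le_primes (x + 1 + (2 * n%:R * x + 1) / delta).
move=> pxd; have p0 : (0 : R) < p%:R by rewrite ltr0n prime_gt0.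
have nx0 : 0 <= n%:R * x by rewrite mulr_ge0//; lra.
have pd : 2 * (n%:R * x) + 1 <= p%:R * delta.
  rewrite -ler_pdivrMr// (le_trans _ pxd)// -mulrA; lra.
have xp : x < p%:R.
  have : 0 <= (2 * n%:R * x + 1) / delta by rewrite -mulrA divr_ge0//; lra.
  lra.
pose e := Num.trunc (p%:R * delta + n%:R * x).
have ele : e%:R <= p%:R * delta + n%:R * x by rewrite truncn_le; lra.
have N3 : N.*2.+1%:R <= 3 * x.
  by rewrite -addn1 natrD -mul2n natrM; lra.
have e5 : e.*2.+1%:R <= p%:R * (5 * delta).
  by rewrite -addn1 natrD -mul2n natrM; lra.
pose T := (sym_residue_box p n N :\ 0)%SET.
pose I := sym_residue_box p m e.
pose Z := [set A : 'M['F_p]_(m, n) | [exists h in T, A *m h \in I]]%SET.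
have cT : (#|T| <= N.*2.+1 ^ n)%N.
  exact: leq_trans (subset_leq_card (subsetDl _ _)) (card_sym_residue_box_le _ _ _).
apply: (@le_trans _ _ (lebesgue_mx_outer
    (unit_cube z `&` [set B | map_mx intr (cell p B) \in Z]))).
  apply: le_outer_measure => B [zB [h [l [h0 hx Bhl]]]]; split=> //.
  have hN j : - N%:Z <= h j 0 <= N%:Z by exact: norm_intr_le_trunc.
  rewrite /= inE; apply/existsP; exists (map_mx intr h); apply/andP; split.
    rewrite !inE mem_sym_residue_box// andbT.
    apply: contra h0 => /eqP/(map_intr_Fp_eq0 p_prime)[v hv].
    apply/eqP/colP => j; rewrite mxE.
    have Np : (N < p)%N by rewrite -(ltr_nat R); lra.
    move: (hN j); rewrite hv mxE; move: (v j 0) => a aN.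
    by rewrite (small_multiple_eq0 Np aN) mulr0.
  have -> : map_mx intr (cell p B) *m map_mx intr h =
      map_mx intr (cell p B *m h + p%:Z *: l) :> 'cV['F_p]_m.
    by rewrite map_mxD map_mxM map_intr_Fp_scale// addr0.
  apply: mem_sym_residue_box => i; apply: (@norm_intr_le_trunc R).
  set c := cell p B *m h + _.
  have -> : (c i 0)%:~R = (map_mx intr c : 'cV[R]_m) i 0 by rewrite [RHS]mxE.
  apply: (le_trans (cV_norm_coord _ _)).
  have -> : map_mx intr c = p%:R *: (B *m map_mx intr h + map_mx intr l) -
      (p%:R *: (B *m map_mx intr h) - map_mx intr (cell p B *m h)) :> 'cV[R]_m.
    by rewrite /c map_mxD map_mxZ scalerDr opprB [RHS]addrC addrA subrK.
  apply: (le_trans (ler_normB _ _)); apply: lerD.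
    by rewrite normrZ (ger0_norm (ltW p0)) ler_pM2l.
  by apply: cell_mulmx_err => //; lra.
apply: (le_trans (outer_cells_le R p_prime z Z)); rewrite lee_fin.
have T0 : 0 \notin T by rewrite !inE eqxx.
have := card_mulmx_hits I T0; rewrite card_Fp// -/Z => cZ.
rewrite ler_pdivrMr ?exprn_gt0// -(ler_pM2r (exprn_gt0 m p0)) mulrAC.
have cZR : #|Z|%:R * p%:R ^+ m <= #|T|%:R * #|I|%:R * p%:R ^+ (m * n) :> R.
  by rewrite -!natrX -!natrM ler_nat.
apply: (le_trans cZR); rewrite ler_wpM2r ?exprn_ge0 ?ler0n//.
rewrite -mulrA -exprMn ler_pM ?ler0n//.
  apply: (@le_trans _ _ (N.*2.+1%:R ^+ n)); first by rewrite -natrX ler_nat.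
  by rewrite lerXn2r ?nnegrE// (le_trans _ N3).
apply: (@le_trans _ _ (e.*2.+1%:R ^+ m)).
  by rewrite -natrX ler_nat card_sym_residue_box_le.
by apply: lerXn2r; rewrite ?nnegrE// 1?mulrC// (le_trans _ e5).
Qed.

(** The case [x ~ 2 H], [eps ~ 2 e / p] of [card_uncovering]: [s] and [t] range
    over [{0..H-1}^n], and [s - t + (H, .., H)] then falls in [(0, x]^n. *)
Lemma outer_uncovered z (x eps : R) : 1 <= x -> 0 < eps ->
  (lebesgue_mx_outer (unit_cube z `&` uncovered x eps)
   <= ((4 / x) ^+ n * (4 / eps) ^+ m)%:E)%E.
Proof.
move=> x1 e0; have [e1|e1] := leP 1 eps.
  (* One point modulo [Z^m] is enough. *)
  rewrite (_ : _ `&` _ = set0) ?outer_measure0 ?lee_fin.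
    by rewrite mulr_ge0// exprn_ge0// divr_ge0//; lra.
  apply/seteqP; split=> // B [_ [w /(_ (const_mx 1))]].
  pose y := w - B *m map_mx intr (const_mx 1).
  move=> /(_ (map_mx Num.floor y)) => far.
  have kx (j : 'I_n) : 0 < (((const_mx 1 : 'cV[int]_n) j 0)%:~R : R) <= x.
    by rewrite mxE ltr01.
  move: (far kx); apply/negP; rewrite -leNgt (le_trans _ e1)// cV_norm_le//.
  apply/forallP => i.
  have -> : B *m map_mx intr (const_mx 1) + map_mx intr (map_mx Num.floor y) - w =
      map_mx intr (map_mx Num.floor y) - y.
    by rewrite opprB [RHS]addrCA addrA.
  rewrite !mxE; have := floor_itv (y i 0); rewrite ler_norml !mxE.
  move: (Num.floor _) => c; lra.
pose H := Num.trunc ((x + 1) / 2).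
have Hx : H%:R <= (x + 1) / 2 by rewrite truncn_le; lra.
have H1 : (1 : R) <= H%:R by rewrite (ler_nat _ 1) truncn_gt_nat mulr1n; lra.
have xH : x <= 4 * H%:R.
  by have := truncnS_gt ((x + 1) / 2); rewrite -/H -[H.+1%:R]natr1; lra.
(* The errors from discretising [B] and [w] must fit in [p * eps / 2], and
   rounding [p * eps / 2] down to [e] may lose at most a factor 2. *)
have [p p_prime] := natr_le_primes (H%:R + (4 + 2 * n%:R * H%:R) / eps).
move=> pHe; have p0 : (0 : R) < p%:R by rewrite ltr0n prime_gt0.
have nH0 : 0 <= n%:R * H%:R :> R by rewrite mulr_ge0.
have pe : 4 + 2 * (n%:R * H%:R) <= p%:R * eps.
  rewrite -ler_pdivrMr// mulrA (le_trans _ pHe)// lerDr; lra.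
pose e := Num.trunc (p%:R * eps / 2).
have ele : e%:R <= p%:R * eps / 2 by rewrite truncn_le; lra.
have lee : p%:R * eps / 4 <= e%:R.
  by have := truncnS_gt (p%:R * eps / 2); rewrite -/e -[e.+1%:R]natr1; lra.
have Hp : (H <= p)%N.
  rewrite -(ler_nat R) (le_trans _ pHe)// lerDl divr_ge0//; lra.
have ep : (e <= p)%N.
  by rewrite -(ler_nat R) (le_trans ele)// ler_pdivrMr// ler_pM2l//; lra.
pose T := residue_box p n H; pose I := residue_box p m e.
have := card_uncovering T I; rewrite card_Fp// !card_residue_box//.
set Z := [set A | _]%SET => cZ.
apply: (@le_trans _ _ (lebesgue_mx_outer
    (unit_cube z `&` [set B | map_mx intr (cell p B) \in Z]))).
  apply: le_outer_measure => B [zB [w Bw]]; split=> //=.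
  apply: contraT => BZ.
  (* [w - B *m k0] is the target for [B *m (s - t)]. *)
  pose k0 : 'cV[int]_n := const_mx H%:Z.
  pose y : 'cV[R]_m := p%:R *: (w - B *m map_mx intr k0).
  pose W : 'cV[int]_m := map_mx Num.floor y.
  move: BZ; rewrite inE negb_exists => /forallP/(_ (map_mx intr W)).
  rewrite negb_forall_in => /exists_inP[_ /residue_box_int[s sH ->]].
  rewrite negb_forall_in => /exists_inP[_ /residue_box_int[t tH ->]].
  rewrite negb_forall_in => /exists_inP[_ /residue_box_int[a aE ->]].
  rewrite negb_forall_in => /exists_inP[_ /residue_box_int[b bE ->]].
  rewrite negbK -!map_mxB -map_mxM -map_mxD -subr_eq0 -map_mxB => /eqP.
  move=> /(map_intr_Fp_eq0 p_prime)[l lE].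
  have kx j : 0 < (((s - t + k0) j 0)%:~R : R) <= x.
    have kj : 0 < (s - t + k0) j 0 <= H%:Z + H%:Z - 1.
      by rewrite !mxE; exact: sub_add_box.
    rewrite ltr0z; case/andP: kj => -> /=; rewrite -(ler_int R).
    rewrite intrB intrD -!pmulrn; lra.
  have far := Bw _ (- l) kx.
  have split_err :
      p%:R *: (B *m map_mx intr (s - t + k0) + map_mx intr (- l) - w) =
      (p%:R *: (B *m map_mx intr (s - t)) - map_mx intr (cell p B *m (s - t)))
      - map_mx intr (a - b) + (map_mx intr W - y) :> 'cV[R]_m.
    have pl : p%:R *: map_mx intr (- l) = map_mx intr W -
        (map_mx intr (cell p B *m (s - t)) + map_mx intr (a - b)) :> 'cV[R]_m.
      rewrite -map_mxD -map_mxB -opprB lE map_mxN scalerN map_mxN map_mxZ.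
      by congr (- _).
    rewrite map_mxD mulmxDr scalerBr !scalerDr pl /y scalerBr.
    move: (p%:R *: w) (p%:R *: (B *m map_mx intr k0)) => pw pk.
    move: (p%:R *: (B *m map_mx intr (s - t))) (map_mx intr (a - b)) => X A.
    move: (map_mx intr (cell p B *m (s - t))) (map_mx intr W) => C D.
    by apply/colP => j; rewrite !mxE; ring.
  have : p%:R * eps < n%:R * H%:R + e%:R + 1.
    apply: (@lt_le_trans _ _
      `|p%:R *: (B *m map_mx intr (s - t + k0) + map_mx intr (- l) - w)|).
      by rewrite normrZ (ger0_norm (ltW p0)) ltr_pM2l.
    rewrite split_err; apply: (le_trans (ler_normD _ _)); apply: lerD.
      apply: (le_trans (ler_normB _ _)); apply: lerD.
        apply: cell_mulmx_err => // j; rewrite !mxE -intr_norm.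
        by rewrite -[H%:R]/(H%:Z%:~R) ler_int norm_sub_box.
      rewrite cV_norm_le//; apply/forallP => j; rewrite !mxE -intr_norm.
      by rewrite -[e%:R]/(e%:Z%:~R) ler_int norm_sub_box.
    rewrite cV_norm_le//; apply/forallP => j.
    rewrite mxE [X in X + _]mxE [X in X%:~R + _]mxE [X in _ + X]mxE ler_norml.
    have := floor_itv (y j 0); move: (Num.floor _) => c.
    rewrite intrD; lra.
  by apply: contraTT => _; rewrite -leNgt; lra.
apply: (le_trans (outer_cells_le R p_prime z Z)); rewrite lee_fin.
rewrite ler_pdivrMr ?exprn_gt0//.
have e00 : 0 < e%:R :> R by lra.
have HE0 : 0 < H%:R ^+ n * e%:R ^+ m :> R by rewrite mulr_gt0 ?exprn_gt0//; lra.
rewrite -(ler_pM2r HE0).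
have cZR : #|Z|%:R * (H%:R ^+ n * e%:R ^+ m) <= p%:R ^+ m * p%:R ^+ (m * n) :> R.
  by rewrite -!natrX -!natrM ler_nat.
apply: (le_trans cZR); rewrite mulrAC ler_wpM2r ?exprn_ge0 ?ler0n//.
rewrite mulrACA -!exprMn -[leLHS]mul1r ler_pM ?exprn_ge0 ?ler0n//.
  by rewrite exprn_ege1// mulrAC ler_pdivlMr; lra.
apply: lerXn2r; rewrite ?nnegrE ?ler0n//.
  by rewrite mulr_ge0 ?divr_ge0//; lra.
rewrite mulrAC ler_pdivlMr; lra.
Qed.

End Measure.

(** * Borel-Cantelli *)

Section BorelCantelli.
Variables (R : realType) (m n : nat).
Implicit Types (E : nat -> set 'M[R]_(m, n)).

Lemma unit_cube_cover (B : 'M[R]_(m, n)) : exists z, unit_cube z B.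
Proof.
exists (map_mx (fun x => Num.ceil x - 1) B) => i j; rewrite mxE.
have := ceil_itv (B i j); move: (Num.ceil _) => c; rewrite intrB; lra.
Qed.

Lemma ae_mono (P P' : 'M[R]_(m, n) -> Prop) : (forall B, P B -> P' B) ->
  (\forall B \ae lebesgue_mx R m n, P B) -> \forall B \ae lebesgue_mx R m n, P' B.
Proof.
move=> PP'; apply: negligibleS => B /= P'B PB; apply: P'B; exact: PP'.
Qed.

(** The Borel-Cantelli lemma, localised to unit cubes because it is meant for
    periodic sets, whose measure is infinite as soon as it is not 0. *)
Lemma ae_eventually_notin (E : nat -> set 'M[R]_(m, n)) (C : R) (c : nat -> R) :
  0 <= C -> (forall j, (0 < j)%N -> 0 <= c j) ->
  (\sum_(1 <= j <oo) (c j)%:E < +oo)%E ->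
  (forall z j, (0 < j)%N ->
    (lebesgue_mx_outer (unit_cube z `&` E j) <= (C * c j)%:E)%E) ->
  \forall B \ae lebesgue_mx R m n,
    exists2 j0, (0 < j0)%N & forall j, (j0 <= j)%N -> ~ E j B.
Proof.
move=> C0 c0 csum Ec; apply/lebesgue_mx_negligibleP.
pose mu : {outer_measure set _ -> \bar R} := @lebesgue_mx_outer R m n.
set bad := ~` _.
have null_cube z : mu (unit_cube z `&` bad) = 0%E.
  pose P := leq 1.
  have tail :
      \big[+%E/0%R]_(N <= k <oo | P k) (C%:E * (c k)%:E)%E @[N --> \oo] --> 0%E.
    apply: nneseries_tail_cvg => [|k Pk]; last first.
      by rewrite mule_ge0 ?lee_fin ?c0.
    rewrite nneseriesZl => [|k Pk]; last by rewrite lee_fin c0.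
    move: csum; rewrite eseries_cond.
    have -> : (\sum_(0 <= i <oo | true && (0 < i)%N) (c i)%:E)%E =
      (\sum_(0 <= i <oo | P i) (c i)%:E)%E by [].
    move=> csum; rewrite lte_mul_pinfty ?lee_fin//.
  apply/eqP; rewrite eq_le outer_measure_ge0 andbT.
  apply: (cvge_ge _ tail).
  near=> N.
  have N1 : (0 < N)%N by near: N; exact: nbhs_infty_gt.
  apply: (@le_trans _ _ (\sum_(N <= i <oo) mu (unit_cube z `&` E i))%E).
    apply: le_trans (outer_measure_sigma_subadditive_tail mu N _).
    apply: le_outer_measure => B [zB badB].
    apply: contrapT => nE; apply: badB; exists N => // j Nj EjB.
    by apply: nE; exists j => //=; apply/negP; rewrite -leqNgt.
  rewrite [leLHS]eseries_cond [leRHS]eseries_cond.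
  apply: (@le_trans _ _
    (\sum_(0 <= i <oo | true && (N <= i)%N) (C%:E * (c i)%:E))%E).
    apply: lee_nneseries => [i _ _|i /= Ni]; first exact: outer_measure_ge0.
    by apply: Ec; exact: leq_trans Ni.
  apply: subset_lee_nneseries => [i /andP[i1 _]|i /= Ni].
    by rewrite mule_ge0 ?lee_fin ?c0.
  by rewrite Ni andbT; exact: leq_trans Ni.
apply/eqP; rewrite eq_le outer_measure_ge0 andbT.
pose cube k := if unpickle k is Some z then unit_cube z `&` bad else set0.
apply: (@le_trans _ _ (mu (\bigcup_k cube k))).
  apply: le_outer_measure => B badB; have [z zB] := unit_cube_cover B.
  by exists (pickle z); rewrite /cube ?pickleK.
apply: (le_trans (outer_measure_sigma_subadditive mu cube)).
rewrite eseries0// => k _ _; rewrite /cube; case: unpickle => [z|].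
  exact: null_cube.
exact: outer_measure0.
Unshelve. all: by end_near.
Qed.

End BorelCantelli.

(** * Norms and cones *)

Section Norms.
Variables (R : realType) (m : nat).
Implicit Types (y u : 'cV[R]_m) (S : set 'cV[R]_m).

Lemma norm_le_lp_norm (p : \bar R) y : (1 <= p)%E -> `|y| <= lp_norm p y.
Proof.
case: p => [r||]//= r1; last first.
  rewrite cV_norm_le; last by elim/big_ind: _ => // a b; rewrite le_max => ->.
  by apply/forallP => i; exact: (le_bigmax _ (fun i => `|y i 0|)).
have r0 : 0 < r by rewrite (lt_le_trans ltr01)// -lee_fin.
rewrite cV_norm_le ?powR_ge0//; apply/forallP => i.
rewrite -[leLHS](@powRr1 _ `|y i 0|)// -(mulfV (lt0r_neq0 r0)) powRrM.
apply: ge0_ler_powR; rewrite ?nnegrE ?invr_ge0 ?powR_ge0 ?(ltW r0)//.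
  by apply: sumr_ge0 => j _; exact: powR_ge0.
by rewrite (bigD1 i)//= lerDl sumr_ge0// => j _; exact: powR_ge0.
Qed.

Lemma lp_norm_le_norm (p : \bar R) y : (0 < m)%N -> (1 <= p)%E ->
  lp_norm p y <= m%:R * `|y|.
Proof.
move=> m0; case: p => [r||]//= r1; last first.
  apply: (@le_trans _ _ `|y|); last by rewrite ler_peMl// ler1n.
  by apply/bigmax_leP; split=> // i _; exact: cV_norm_coord.
have {}r1 : 1 <= r by rewrite -lee_fin.
have r0 : 0 < r by rewrite (lt_le_trans ltr01).
have m1 : 1 <= m%:R :> R by rewrite ler1n.
have sum_le : \sum_i `|y i 0| `^ r <= m%:R * `|y| `^ r.
  rewrite -[m in m%:R]card_ord mulr_natl -sumr_const; apply: ler_sum => i _.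
  by apply: ge0_ler_powR; rewrite ?nnegrE ?(ltW r0)// cV_norm_coord.
apply: (@le_trans _ _ ((m%:R * `|y| `^ r) `^ r^-1)).
  apply: ge0_ler_powR; rewrite ?nnegrE ?invr_ge0 ?mulr_ge0 ?powR_ge0 ?(ltW r0)//.
  by apply: sumr_ge0 => i _; exact: powR_ge0.
rewrite powRM ?powR_ge0// -powRrM mulfV ?gt_eqF// powRr1// ler_wpM2r//.
by rewrite ler1_powR// invf_le1.
Qed.

Lemma lp_normN (p : \bar R) y : lp_norm p (- y) = lp_norm p y.
Proof.
have N i : `|(- y) i 0| = `|y i 0| by rewrite mxE normrN.
case: p => [r| |]; rewrite /lp_norm; [|by apply: eq_bigr => i _; rewrite N|by []].
by congr (_ `^ _); apply: eq_bigr => i _; rewrite N.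
Qed.

Lemma lp_norm2E y : lp_norm 2%:E y = Num.sqrt (\sum_i y i 0 ^+ 2).
Proof.
rewrite /lp_norm -powR12_sqrt; last by apply: sumr_ge0 => i _; exact: sqr_ge0.
congr (_ `^ _); apply: eq_bigr => i _.
by rewrite (@powR_mulrn _ _ 2)// real_normK// num_real.
Qed.

Lemma lp_norm2Z (a : R) y : 0 <= a -> lp_norm 2%:E (a *: y) = a * lp_norm 2%:E y.
Proof.
move=> a0; rewrite !lp_norm2E.
under eq_bigr do rewrite mxE exprMn.
by rewrite -mulr_sumr sqrtrM ?sqr_ge0// sqrtr_sqr ger0_norm.
Qed.

Lemma lp_norm2_0 : lp_norm 2%:E (0 : 'cV[R]_m) = 0.
Proof.
by rewrite lp_norm2E big1 ?sqrtr0// => i _; rewrite mxE expr0n.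
Qed.

Lemma lp_norm2_gt0 y : y != 0 -> 0 < lp_norm 2%:E y.
Proof.
move=> y0; apply: (@lt_le_trans _ _ `|y|); first by rewrite normr_gt0.
by apply: norm_le_lp_norm; rewrite lee_fin ler1n.
Qed.

Lemma normalize_sphere y : y != 0 ->
  unit_sphere R m ((lp_norm 2%:E y)^-1 *: y).
Proof.
move=> /lp_norm2_gt0 y0.
by rewrite /unit_sphere /mkset lp_norm2Z ?invr_ge0 ?(ltW y0)// mulVf// gt_eqF.
Qed.

Lemma cone_neq0 S y : S `<=` unit_sphere R m -> cone S y -> y != 0.
Proof.
move=> S1 [c [u [c0 /S1 u1 ->]]]; rewrite scaler_eq0 gt_eqF//=.
apply: contra_eq_neq u1 => ->.
by rewrite lp_norm2_0 eq_sym oner_neq0.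
Qed.

Lemma continuous_lp_norm2 : continuous (@lp_norm R m 2%:E).
Proof.
have -> : @lp_norm R m 2%:E = Num.sqrt \o (\sum_i fun y : 'cV[R]_m => y i 0 ^+ 2).
  by apply/funext => y; rewrite lp_norm2E /= fct_sumE.
move=> y; apply: continuous_comp; last exact: sqrt_continuous.
move: y; apply: (big_ind (fun g : 'cV[R]_m -> R => continuous g)) =>
  [y|g h cg ch y|i _ y].
- exact: (@cst_continuous 'cV[R]_m R 0 y).
- by apply: continuousD; [exact: cg|exact: ch].
- apply: (@continuous_comp _ _ _ (fun y : 'cV[R]_m => y i 0) (fun x => x ^+ 2)).
    exact: coord_continuous.
  exact: exprn_continuous.
Qed.

(** Normalisation is continuous at a point of [S], so a ball around that point
    lies in the cone, and the cone is invariant under scaling. *)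
Lemma open_cone_ball S : S !=set0 -> open_in_sphere S ->
  exists u0 rho, 0 < rho /\ forall (r : R) y,
    0 < r -> `|y - r *: u0| < r * rho -> cone S y.
Proof.
move=> [u0 Su0] [U openU SU]; move: (Su0); rewrite SU => -[Uu0 u01].
pose g y := (lp_norm 2%:E y)^-1 *: y.
have gu0 : g u0 = u0 by rewrite /g u01 invr1 scale1r.
have cont_g : {for u0, continuous g}.
  have cont_inv : (lp_norm 2%:E y)^-1 @[y --> u0] --> (lp_norm 2%:E u0)^-1.
    apply: (@cvgV _ _ (nbhs u0)); first by rewrite u01 oner_neq0.
    exact: continuous_lp_norm2.
  exact: (cvgZ cont_inv cvg_id).
have nearU : \forall y \near u0, U (g y).
  by apply: cont_g; rewrite /= gu0; exact: open_nbhs_nbhs.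
have near0 : \forall y \near u0, 0 < lp_norm 2%:E y.
  apply: (@cvgr_gt _ _ (nbhs u0) _ _ _ (@continuous_lp_norm2 u0)).
  by rewrite u01.
have [rho rho0 ball_U] : exists2 rho : R, 0 < rho & forall y, `|u0 - y| < rho ->
    U (g y) /\ 0 < lp_norm 2%:E y.
  have : nbhs u0 [set y | U (g y) /\ 0 < lp_norm 2%:E y].
    exact: (filterI nearU near0).
  move=> /nbhs_ballP[rho /= rho0 sub].
  by exists rho => // y yu0; apply: sub; rewrite -ball_normE.
exists u0, rho; split=> // r y r0 yr.
have [Ugy y0] : U (g (r^-1 *: y)) /\ 0 < lp_norm 2%:E (r^-1 *: y).
  apply: ball_U; rewrite -(ltr_pM2l r0); apply: le_lt_trans yr.
  rewrite -{1}(ger0_norm (ltW r0)) -normrZ distrC scalerBr scalerA mulfV ?gt_eqF//.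
  by rewrite scale1r.
exists (r * lp_norm 2%:E (r^-1 *: y)), (g (r^-1 *: y)); split.
- by rewrite mulr_gt0.
- split; [exact: Ugy|apply: normalize_sphere].
  by apply: contraTneq y0 => ->; rewrite lp_norm2_0 ltxx.
- move: y0; rewrite /g; move: (lp_norm _ _) => N N0.
  rewrite !scalerA. by rewrite mulrA mulfK ?gt_eqF// mulfV ?gt_eqF// scale1r.
Qed.

End Norms.

(** * Pigeonhole arguments *)

Section Counting.
Variables (R : realType) (m n : nat).
Implicit Types (B : 'M[R]_(m, n)).

(** There are more vectors [k] than cubes of side [1 / M] in the torus. *)
Lemma pigeonhole_approx B (N M : nat) : (0 < M)%N -> (M ^ m < N ^ n)%N ->
  exists (k k' : 'cV[int]_n) (l : 'cV[int]_m),
    [/\ k != k', forall j, 0 < k j 0 <= N%:Z, forall j, 0 < k' j 0 <= N%:Z &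
        `|B *m map_mx intr (k - k') + map_mx intr l| <= M%:R^-1].
Proof.
case: M => // M _ MN.
pose kk (u : 'cV['I_N]_n) : 'cV[int]_n := \col_j ((u j 0 : nat).+1)%:Z.
pose a u : 'cV[R]_m := B *m map_mx intr (kk u).
pose fl u : 'cV[int]_m := map_mx Num.floor (a u).
pose c u : 'cV['I_M.+1]_m :=
  \col_i inord (Num.trunc (M.+1%:R * (a u i 0 - (fl u i 0)%:~R))).
have : ~~ injectiveb c.
  apply/negP => /injectiveP/leq_card; rewrite !card_mx !card_ord !muln1.
  by rewrite leqNgt MN.
move=> /injectivePn[u [v uv cuv]].
have kk_box w j : 0 < kk w j 0 <= N%:Z.
  by rewrite mxE; have := ltn_ord (w j 0); lia.
exists (kk u), (kk v), (fl v - fl u); split; [|exact: kk_box|exact: kk_box|].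
  apply: contra uv => /eqP/colP kuv; apply/eqP/colP => j; apply/val_inj/eqP.
  by have := kuv j; rewrite !mxE => /eqP.
rewrite cV_norm_le ?invr_ge0//; apply/forallP => i.
have M0 : (0 : R) < M.+1%:R by [].
rewrite map_mxB mulmxBr -/(a u) -/(a v) map_mxB.
have -> : (a u - a v + (map_mx intr (fl v) - map_mx intr (fl u))) i 0 =
  (a u i 0 - (fl u i 0)%:~R) - (a v i 0 - (fl v i 0)%:~R).
  by move: (a u) (a v) (fl u) (fl v) => X Y P Q; rewrite !mxE; ring.
have frac w : 0 <= M.+1%:R * (a w i 0 - (fl w i 0)%:~R) < M.+1%:R.
  rewrite [fl w i 0]mxE; have := floor_itv (a w i 0).
  move: (Num.floor _) => z; rewrite intrD => az.
  by rewrite pmulr_rge0// gtr_pMr//; lra.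
have cE w : (c w i 0 : nat) = Num.trunc (M.+1%:R * (a w i 0 - (fl w i 0)%:~R)).
  have /andP[w0 wM] := frac w.
  by rewrite [c w i 0]mxE inordK// truncn_lt_nat.
have := congr1 (fun z : 'cV['I_M.+1]_m => (z i 0 : nat)) cuv; rewrite !cE.
move: (frac u) (frac v); move: (a u i 0 - _) (a v i 0 - _) => x y.
move=> /andP[x0 xM] /andP[y0 yM] txy.
have := truncn_itv x0; have := truncn_itv y0; rewrite txy.
move: (Num.trunc _) => t; rewrite -[t.+1%:R]natr1 => ty tx.
rewrite -(ler_pM2l M0) mulfV ?gt_eqF// -[M.+1%:R in leLHS](ger0_norm (ltW M0)).
by rewrite -normrM mulrBr ler_norml; lra.
Qed.

Lemma int_lt1_eq0 (a : int) : (`|a%:~R : R| < 1) -> a = 0.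
Proof.
rewrite -intr_norm -[X in _ < X]/(1%:~R : R) ltr_int ltr_norml; lia.
Qed.

Lemma small_class_eq (L a b : nat) (q : int) :
  (a < L)%N -> (b < L)%N -> a%:Z - b%:Z = L%:Z * q -> a = b.
Proof. by move=> aL bL abq; have q0 : q = 0; nia. Qed.

Lemma absz_pred_box (N : nat) (a b : int) :
  0 < a <= N.+1%:Z -> 0 < b <= N.+1%:Z ->
  [/\ (absz (a - 1)%R < N.+1)%N, (absz (b - 1)%R < N.+1)%N &
      absz (a - 1)%R = absz (b - 1)%R -> a = b].
Proof. by move=> aN bN; split; lia. Qed.

(** Two points of the grid [(1 / L) Z^m] that are distinct modulo [Z^m] are too
    far apart to be approximated by the same [B *m k] modulo [Z^m]. *)
Lemma covering_count B (N L : nat) (r : R) : (0 < N)%N -> (0 < L)%N ->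
  2 * r * L%:R < 1 ->
  (forall v : 'cV[R]_m, exists (k : 'cV[int]_n) (l : 'cV[int]_m),
    (forall j, 0 < k j 0 <= N%:Z) /\
    `|B *m map_mx intr k + map_mx intr l - v| <= r) ->
  (L ^ m <= N ^ n)%N.
Proof.
case: N => // N _ L0 rL cov.
have LR : (0 : R) < L%:R by rewrite ltr0n.
pose v (z : 'cV['I_L]_m) : 'cV[R]_m := \col_i ((z i 0 : nat)%:R / L%:R).
have /choice[kl klP] : forall z, exists kl : 'cV[int]_n * 'cV[int]_m,
    (forall j, 0 < kl.1 j 0 <= N.+1%:Z) /\
    `|B *m map_mx intr kl.1 + map_mx intr kl.2 - v z| <= r.
  by move=> z; have [k [l kl]] := cov (v z); exists (k, l).
pose g z : 'cV['I_N.+1]_n := \col_j inord (absz ((kl z).1 j 0 - 1)%R).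
suff /leq_card : injective g by rewrite !card_mx !card_ord !muln1.
move=> z w gzw.
have kzw : (kl z).1 = (kl w).1.
  apply/colP => j; have := congr1 (fun u : 'cV['I_N.+1]_n => (u j 0 : nat)) gzw.
  rewrite !mxE; have := (klP z).1 j; have := (klP w).1 j.
  move: ((kl z).1 j 0) ((kl w).1 j 0) => a b bN aN.
  by have [aN' bN' inj] := absz_pred_box aN bN; rewrite !inordK.
apply/colP => i; apply/val_inj => /=.
apply: (@small_class_eq L _ _ ((kl z).2 i 0 - (kl w).2 i 0)) => //.
apply/eqP; rewrite -subr_eq0; apply/eqP/int_lt1_eq0.
have [_ /(le_trans (cV_norm_coord _ i))] := klP z.
have [_ /(le_trans (cV_norm_coord _ i))] := klP w.
rewrite kzw; move: (B *m _) => b.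
rewrite !intrB intrM intrB !mxE -!pmulrn.
move: (b i 0) (((kl z).2 i 0)%:~R) (((kl w).2 i 0)%:~R) => c lz lw.
move: ((z i 0 : nat)%:R) ((w i 0 : nat)%:R) => zi wi.
have scaled t : `|t| <= r -> `|t * L%:R| <= r * L%:R.
  by rewrite normrM (ger0_norm (ltW LR)) ler_pM2r.
move=> /scaled + /scaled.
rewrite !mulrBl !divfK ?gt_eqF// !ler_norml ltr_norml; lra.
Qed.

End Counting.

Section Summable.
Variables (R : realType) (f : R -> R).
Hypotheses (f_gt0 : forall x, 0 < x -> 0 < f x)
  (f_mono : forall x y, 0 < x -> x <= y -> f x <= f y)
  (f_sum : (\sum_(1 <= k <oo) ((f k%:R)^-1)%:E < +oo)%E).

(** Otherwise the terms [(f k)^-1] would be bounded away from [0]. *)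
Lemma f_unbounded (A : R) : exists2 k : nat, (0 < k)%N &
  forall x, k%:R <= x -> A <= f x.
Proof.
apply: contrapT => bounded.
have fA k : (0 < k)%N -> f k%:R < A.
  move=> k0; rewrite ltNge; apply/negP => Af; apply: bounded; exists k => // x kx.
  by rewrite (le_trans Af)// f_mono// ltr0n.
have A0 : 0 < A by rewrite (lt_trans _ (fA 1%N _))// f_gt0.
have fin : (\sum_(1 <= k <oo) ((f k%:R)^-1)%:E \is a fin_num)%E.
  rewrite ge0_fin_numE// nneseries_ge0// => k k1 _.
  by rewrite lee_fin invr_ge0 ltW// f_gt0// ltr0n.
have le_sum N : N%:R * A^-1 <= fine (\sum_(1 <= k <oo) ((f k%:R)^-1)%:E)%E.
  rewrite -lee_fin fineK//.
  apply: (@le_trans _ _ (\sum_(1 <= k < N.+1) ((f k%:R)^-1)%:E)%E); last first.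
    apply: nneseries_lim_ge => k k1 _.
    by rewrite lee_fin invr_ge0 ltW// f_gt0// ltr0n.
  rewrite sumEFin lee_fin -[N in N%:R](subn1 N.+1) mulr_natl -sumr_const_nat.
  apply: ler_sum_nat => k /andP[k1 _].
  by rewrite lef_pV2 ?posrE ?f_gt0 ?ltr0n// ltW// fA.
have := le_sum (Num.trunc (A * fine (\sum_(1 <= k <oo) ((f k%:R)^-1)%:E)%E)).+1.
by rewrite ler_pdivrMr// leNgt mulrC truncnS_gt.
Qed.

End Summable.

(** * Almost every matrix is eventually good at the scales e^j *)

Section LogScale.
Variable R : realType.

Lemma powR_expR (Q a : R) : 0 < Q -> Q `^ a = expR (a * ln Q).
Proof. by move=> Q0; rewrite /powR gt_eqF. Qed.

Lemma powR_invn_exprn (a : R) m : (0 < m)%N -> 0 <= a ->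
  (a `^ m%:R^-1) ^+ m = a.
Proof.
move=> m0 a0; rewrite -powR_mulrn ?powR_ge0// -powRrM mulVf ?powRr1//.
by rewrite pnatr_eq0 -lt0n.
Qed.

Lemma expR_divn_exprn (x : R) n : (0 < n)%N -> expR (x / n%:R) ^+ n = expR x.
Proof. by move=> n0; rewrite -expRM_natl mulrC divfK// pnatr_eq0 -lt0n. Qed.

Lemma near_pinfty_log (P : R -> Prop) (j0 : nat) :
  (forall j Q, (j0 <= j)%N -> 1 <= Q -> j%:R <= ln Q < j.+1%:R -> P Q) ->
  \forall Q \near +oo, P Q.
Proof.
move=> hP; near=> Q.
have Q1 : 1 <= Q by near: Q; apply: nbhs_pinfty_ge; rewrite num_real.
have Qj : expR j0%:R <= Q by near: Q; apply: nbhs_pinfty_ge; rewrite num_real.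
have Q0 : 0 < Q by rewrite (lt_le_trans ltr01).
have jQ : j0%:R <= ln Q by rewrite -ler_expR lnK.
have lnQ0 : 0 <= ln Q by rewrite (le_trans _ jQ).
apply: (hP (Num.trunc (ln Q))) => //; last exact: truncn_itv.
by rewrite truncn_ge_nat.
Unshelve. all: by end_near.
Qed.

End LogScale.

Section ZeroOneLaws.
Variables (R : realType) (m n : nat) (f : R -> R).
Hypotheses (m_gt0 : (0 < m)%N) (n_gt0 : (0 < n)%N)
  (f_gt0 : forall x, 0 < x -> 0 < f x)
  (f_sum : (\sum_(1 <= k <oo) ((f k%:R)^-1)%:E < +oo)%E).

Let fj_gt0 j : (0 < j)%N -> 0 < f j%:R.
Proof. by move=> j0; rewrite f_gt0// ltr0n. Qed.

Let finv_ge0 j : (0 < j)%N -> 0 <= (f j%:R)^-1.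
Proof. by move=> /fj_gt0/ltW; rewrite invr_ge0. Qed.

(** For [x = e^(j/n)] the bound of [outer_uncovered] is a constant times
    [(f j)^-1]. The exponent [j + 1] makes the radius small enough for all [Q]
    with [j <= ln Q < j + 1]. *)
Lemma ae_covered (c : R) : 0 < c -> \forall B \ae lebesgue_mx R m n,
  exists2 j0, (0 < j0)%N & forall j, (j0 <= j)%N ->
    ~ uncovered (expR (j%:R / n%:R))
        (c * (expR (- j.+1%:R / m%:R) * f j%:R `^ m%:R^-1)) B.
Proof.
move=> c0; pose C : R := 4 ^+ n * (4 / c) ^+ m * expR 1.
apply: (@ae_eventually_notin _ _ _ _ C (fun j => (f j%:R)^-1)) => //.
  by rewrite !mulr_ge0 ?exprn_ge0 ?divr_ge0 ?expR_ge0// ltW.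
move=> z j j0; have fj := fj_gt0 j0.
have e0 : 0 < c * (expR (- j.+1%:R / m%:R) * f j%:R `^ m%:R^-1).
  by rewrite !mulr_gt0 ?expR_gt0 ?powR_gt0.
have x1 : 1 <= expR (j%:R / n%:R) :> R by rewrite -expR0 ler_expR divr_ge0.
apply: (le_trans (outer_uncovered z x1 e0)); rewrite lee_fin le_eqVlt.
apply/orP; left; apply/eqP.
rewrite !expr_div_n !exprMn expR_divn_exprn// expR_divn_exprn//.
rewrite powR_invn_exprn ?ltW// /C expr_div_n expRN -[j.+1%:R]natr1 expRD.
by field; rewrite !gt_eqF ?exprn_gt0 ?expR_gt0.
Qed.

(** Dually to [ae_covered], here [x] is the largest and the radius is taken at
    the smallest [Q] with [j <= ln Q < j + 1]. *)
Lemma ae_separated : \forall B \ae lebesgue_mx R m n,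
  exists2 j0, (0 < j0)%N & forall j, (j0 <= j)%N ->
    ~ small_value (expR (j.+1%:R / n%:R))
        (2 * (expR (- j%:R / m%:R) * f j%:R `^ (- m%:R^-1))) B.
Proof.
pose C : R := 3 ^+ n * 10 ^+ m * expR 1.
apply: (@ae_eventually_notin _ _ _ _ C (fun j => (f j%:R)^-1)) => //.
  by rewrite !mulr_ge0 ?exprn_ge0 ?expR_ge0.
move=> z j j0; have fj := fj_gt0 j0.
have e0 : 0 < 2 * (expR (- j%:R / m%:R) * f j%:R `^ (- m%:R^-1)).
  by rewrite !mulr_gt0 ?expR_gt0 ?powR_gt0.
have x1 : 1 <= expR (j.+1%:R / n%:R) :> R by rewrite -expR0 ler_expR divr_ge0.
apply: (le_trans (outer_small_value z x1 e0)); rewrite lee_fin le_eqVlt.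
apply/orP; left; apply/eqP.
rewrite mulrA (_ : 5 * 2 = 10); last by ring.
rewrite !exprMn expR_divn_exprn// expR_divn_exprn// powRN exprVn.
rewrite powR_invn_exprn ?ltW// /C -[j.+1%:R]natr1 expRD expRN.
by field; rewrite !gt_eqF ?expR_gt0.
Qed.

End ZeroOneLaws.

(** * From covering and separation to directional gaps *)

Section Gaps.
Variables (R : realType) (m n : nat) (p : \bar R) (S : set 'cV[R]_m).
Hypotheses (m_gt0 : (0 < m)%N) (p_ge1 : (1 <= p)%E).
Implicit Types (B : 'M[R]_(m, n)) (Q : R) (v : 'cV[R]_m).

Lemma int_box_trunc Q (k : 'cV[int]_n) : int_box Q k <->
  forall j, 0 < k j 0 <= (Num.trunc (Q `^ n%:R^-1))%:Z.
Proof.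
have E j : (0 < ((k j 0)%:~R : R) <= Q `^ n%:R^-1) =
    (0 < k j 0 <= (Num.trunc (Q `^ n%:R^-1))%:Z).
  rewrite ltr0z; case: (k j 0) => [a|a]//=.
  by rewrite lez_nat truncn_ge_nat ?powR_ge0.
by split=> kQ j; [rewrite -E|rewrite E]; exact: kQ.
Qed.

Lemma gamma_le B Q v (k : 'cV[int]_n) (l : 'cV[int]_m) :
  int_box Q k -> cone S (B *m map_mx intr k + map_mx intr l - v) ->
  (gamma p S B Q v <=
    (lp_norm p (B *m map_mx intr k + map_mx intr l - v))%:E)%E.
Proof.
move=> Qk Sy; apply: ereal_inf_lbound.
by exists (B *m map_mx intr k + map_mx intr l - v) => //; split=> //; exists k, l.
Qed.

Lemma gamma_lt B Q v (a : R) : (gamma p S B Q v < a%:E)%E ->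
  exists (k : 'cV[int]_n) (l : 'cV[int]_m),
    [/\ int_box Q k, cone S (B *m map_mx intr k + map_mx intr l - v) &
        lp_norm p (B *m map_mx intr k + map_mx intr l - v) < a].
Proof.
move=> /ereal_inf_lt[_ [y [[k [l [Qk ->]]] Sy] <-]]; rewrite lte_fin => ya.
by exists k, l.
Qed.

(** Aim at [v + r *: u0] instead of [v], with [r] a multiple of [eps]
    for which the [eps]-ball around [r *: u0] lies in the cone. *)
Lemma gamma_le_covered B Q v (x eps rho : R) (u0 : 'cV[R]_m) :
  0 < eps -> 0 < rho ->
  (forall r y, 0 < r -> `|y - r *: u0| < r * rho -> cone S y) ->
  x <= Q `^ n%:R^-1 -> ~ uncovered x eps B ->
  (gamma p S B Q v <= (m%:R * (2 / rho * `|u0| + 1) * eps)%:E)%E.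
Proof.
move=> e0 rho0 cone_S xQ /forallNP/(_ (v + (2 * eps / rho) *: u0)).
move=> /existsNP[k /existsNP[l /not_implyP[kx /negP]]]; rewrite -leNgt.
rewrite opprD addrA; set y := _ - v => yu0.
have r0 : 0 < 2 * eps / rho by rewrite divr_gt0// mulr_gt0.
have Sy : cone S y.
  apply: (cone_S (2 * eps / rho)) => //; apply: (le_lt_trans yu0).
  by rewrite divfK ?gt_eqF//; lra.
apply: (@le_trans _ _ (lp_norm p y)%:E).
  apply: gamma_le => // j; have /andP[-> kjx] := kx j.
  by rewrite /= (le_trans kjx).
rewrite lee_fin (le_trans (lp_norm_le_norm _ _ _))// -mulrA ler_pM2l ?ltr0n//.
rewrite -[y](subrK ((2 * eps / rho) *: u0)) (le_trans (ler_normD _ _))//.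
rewrite normrZ (ger0_norm (ltW r0)).
rewrite [leRHS](_ : _ = eps + 2 * eps / rho * `|u0|); last by ring.
by rewrite lerD2r.
Qed.

(** Two points of [K B Q] given by the same [k] differ by an integer vector,
    of norm at least 1 if it lies in the cone; hence the condition [delta <= 1]. *)
Lemma gamma_ge_separated B Q v (x delta : R) :
  S `<=` unit_sphere R m -> delta <= 1 -> Q `^ n%:R^-1 <= x ->
  ~ small_value x delta B -> K B Q v -> (delta%:E <= gamma p S B Q v)%E.
Proof.
move=> S1 d1 Qx Bsep [k' [l' [Qk' ->]]].
apply: le_ereal_inf_tmp => _ [y [[k [l [Qk yE]]] Sy] <-].
have y0 := cone_neq0 S1 Sy.
rewrite lee_fin (le_trans _ (norm_le_lp_norm _ p_ge1))//.
have {}yE : y = B *m map_mx intr (k - k') + map_mx intr (l - l').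
  by rewrite yE !map_mxB mulmxBr opprD addrACA.
have [kk'|kk'] := eqVneq k k'.
  move: yE y0; rewrite kk' subrr map_mx0 mulmx0 add0r => -> ll'.
  have [i li] : exists i, (l - l') i 0 != 0.
    apply/existsP; rewrite -negb_forall; apply: contra ll' => /forallP l0.
    by apply/eqP/colP => i; rewrite mxE (eqP (l0 i)) mxE.
  apply: (le_trans d1); apply: le_trans (cV_norm_coord _ i).
  rewrite mxE -intr_norm -[1]/(1%:~R : R) ler_int.
  by move: (_ i 0) li => a; rewrite -normr_gt0.
rewrite leNgt; apply/negP => ydelta; apply: Bsep; exists (k - k'), (l - l').
split; [by rewrite subr_eq0| |by rewrite -yE ltW].
move=> j; rewrite !mxE; have := Qk j; have := Qk' j.
by rewrite rmorphB/= ler_norml; lra.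
Qed.

End Gaps.

(** * The four bounds *)

Lemma lt_double_mul m n : (0 < m)%N -> (n < 2 * ((m + n) * m))%N.
Proof. nia. Qed.

Section Parts.
Variables (R : realType) (m n : nat) (p : \bar R) (S : set 'cV[R]_m) (f : R -> R).
Hypotheses (p_ge1 : (1 <= p)%E) (m_gt0 : (0 < m)%N) (n_gt0 : (0 < n)%N)
  (S_neq0 : S !=set0) (S_open : open_in_sphere S)
  (f_gt0 : forall x, 0 < x -> 0 < f x)
  (f_mono : forall x y, 0 < x -> x <= y -> f x <= f y)
  (f_sum : (\sum_(1 <= k <oo) ((f k%:R)^-1)%:E < +oo)%E).

Let lnQ_gt0 (Q : R) j : (0 < j)%N -> j%:R <= ln Q -> 0 < ln Q.
Proof. by move=> j0; apply: lt_le_trans; rewrite ltr0n. Qed.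

(** The cone enlarges the covering radius by a constant [D], which is absorbed in
    the constant of [ae_covered]; an extra factor 2 makes the bound strict. *)
Lemma sup_gamma_lt : \forall B \ae lebesgue_mx R m n, \forall Q \near +oo,
   (ereal_sup [set gamma p S B Q v | v in K B Q]
      <= ereal_sup [set gamma p S B Q v | v in [set: 'cV[R]_m]])%E /\
   (ereal_sup [set gamma p S B Q v | v in [set: 'cV[R]_m]]
      < (Q `^ (- m%:R^-1) * f (ln Q) `^ m%:R^-1)%:E)%E.
Proof.
have [u0 [rho [rho0 cone_S]]] := open_cone_ball S_neq0 S_open.
pose D := m%:R * (2 / rho * `|u0| + 1).
have D0 : 0 < D.
  by rewrite mulr_gt0 ?ltr0n// ltr_wpDl// mulr_ge0// divr_ge0// ltW.
have c0 : 0 < (2 * D)^-1 by rewrite invr_gt0 mulr_gt0.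
apply: (ae_mono _ (ae_covered m_gt0 n_gt0 f_gt0 f_sum c0)) => B [j0 j0_gt0 Bj].
apply: (@near_pinfty_log _ _ j0).
move=> j Q j0j Q1 /andP[jQ Qj]; have Q0 : 0 < Q by lra.
have j_gt0 : (0 < j)%N by exact: leq_trans j0j.
have jR : (0 : R) < j%:R by rewrite ltr0n.
split; first by apply: ereal_sup_le; exact: image_subset.
have eps0 : 0 < expR (- j.+1%:R / m%:R) * f j%:R `^ m%:R^-1.
  by rewrite mulr_gt0 ?expR_gt0 ?powR_gt0 ?f_gt0.
apply: (@le_lt_trans _ _
    (2^-1 * (expR (- j.+1%:R / m%:R) * f j%:R `^ m%:R^-1))%:E).
  apply: ge_ereal_sup => _ [v _ <-].
  have e0 := mulr_gt0 c0 eps0.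
  have xQ : expR (j%:R / n%:R) <= Q `^ n%:R^-1.
    by rewrite powR_expR// ler_expR mulrC ler_wpM2l// invr_ge0.
  apply: (le_trans (gamma_le_covered m_gt0 p_ge1 v e0 rho0 cone_S xQ (Bj j j0j))).
  rewrite lee_fin -/D mulrA (_ : D * (2 * D)^-1 = 2^-1)//.
  by field; rewrite gt_eqF.
rewrite lte_fin (@lt_le_trans _ _ (expR (- j.+1%:R / m%:R) * f j%:R `^ m%:R^-1))//.
  by rewrite gtr_pMl//; lra.
rewrite ler_pM ?expR_ge0 ?powR_ge0//.
  rewrite powR_expR// ler_expR mulNr mulNr lerN2 mulrC.
  by rewrite ler_pM2r ?invr_gt0 ?ltr0n// ltW.
apply: ge0_ler_powR; rewrite ?nnegrE ?invr_ge0 ?(ltW (f_gt0 _))//.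
  exact: lnQ_gt0 jQ.
exact: f_mono.
Qed.

(** At most [Q] balls of radius [T = Q^(-1/m) f(ln Q)^(-1/m^2)] cannot cover the
    torus, because [Q * T^m = f(ln Q)^(-1/m)] tends to [0]. *)
Lemma lt_sup_gamma (B : 'M[R]_(m, n)) : \forall Q \near +oo,
  ((Q `^ (- m%:R^-1) * f (ln Q) `^ (- (m%:R ^+ 2)^-1))%:E
     < ereal_sup [set gamma p S B Q v | v in [set: 'cV[R]_m]])%E.
Proof.
have [k0 k0_gt0 f_large] := f_unbounded f_gt0 f_mono f_sum (16 ^+ (m * m) + 1).
apply: (@near_pinfty_log _ _ k0) => j Q k0j Q1 /andP[jQ _].
have Q0 : 0 < Q by lra.
have {f_large} fQ : 16 ^+ (m * m) < f (ln Q).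
  rewrite (lt_le_trans _ (f_large _ _)) ?ltrDl//.
  by rewrite (le_trans _ jQ)// ler_nat.
have fQ0 : 0 < f (ln Q) by rewrite (lt_trans _ fQ)// exprn_gt0.
set T := Q `^ _ * _; rewrite ltNge; apply/negP => supT.
have T0 : 0 < T by rewrite mulr_gt0 ?powR_gt0.
(* The threshold [16^(m*m)] on [f] is chosen for this inequality, which says
   that a grid of mesh [16 T] has more than [Q] points. *)
have Tm : Q * (16 * T) ^+ m < 1.
  have TmE : T ^+ m = Q^-1 * (f (ln Q) `^ m%:R^-1)^-1.
    rewrite exprMn powRN exprVn powR_invn_exprn ?(ltW Q0)//; congr (_ * _).
    rewrite powRN exprVn -powR_mulrn ?powR_ge0// -powRrM expr2 invfM.
    by rewrite -mulrA mulVf ?mulr1// gt_eqF ?ltr0n.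
  rewrite exprMn TmE mulrCA mulVKf ?gt_eqF// ltr_pdivrMr ?powR_gt0// mul1r.
  rewrite -(@ltr_pXn2r _ m)// ?nnegrE ?exprn_ge0 ?powR_ge0//.
  by rewrite -exprM powR_invn_exprn// ltW.
clearbody T.
have T1 : 16 * T < 1.
  rewrite -(@expr_lt1 _ m)// ?mulr_ge0 ?ltW//.
  by apply: le_lt_trans Tm; rewrite ler_peMl// exprn_ge0// mulr_ge0// ltW.
pose N := Num.trunc (Q `^ n%:R^-1); pose L := Num.trunc (8 * T)^-1.
have N_gt0 : (0 < N)%N.
  rewrite truncn_gt0 powR_expR// -expR0 ler_expR mulr_ge0 ?invr_ge0//.
  by rewrite ln_ge0.
have T8_le1 : 8 * T <= 1 by lra.
have L1 : 1 <= (8 * T)^-1 by rewrite invf_ge1 ?mulr_gt0.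
have L_gt0 : (0 < L)%N by rewrite truncn_gt0.
have /andP[leL ltL] : L%:R <= (8 * T)^-1 < L.+1%:R.
  by apply: truncn_itv; rewrite (le_trans ler01).
have L16 : 1 <= L%:R * (16 * T).
  have L1' : (1 : R) <= L%:R by rewrite ler1n.
  have T8 : 0 < 8 * T by rewrite mulr_gt0.
  move: ltL; rewrite -[L.+1%:R]natr1 -(ltr_pM2r T8) mulVf ?gt_eqF// => ltL.
  have : 1 * (8 * T) <= L%:R * (8 * T) by rewrite ler_pM2r.
  lra.
suff : (L ^ m <= N ^ n)%N.
  rewrite -(ler_nat R) !natrX leNgt => /negP; apply.
  apply: (@le_lt_trans _ _ Q).
    rewrite -[leRHS](powR_invn_exprn n_gt0 (ltW Q0)) lerXn2r ?nnegrE ?powR_ge0//.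
    by rewrite truncn_le powR_ge0.
  have T16 : 0 < (16 * T) ^+ m by rewrite exprn_gt0 ?mulr_gt0.
  rewrite -(ltr_pM2r T16) (lt_le_trans Tm)// -exprMn exprn_ege1//.
apply: (@covering_count R m n B N L (2 * T)) => //.
  move: leL; rewrite -(ler_pM2r (_ : 0 < 8 * T)) ?mulr_gt0// mulVf; last first.
    by rewrite gt_eqF// mulr_gt0.
  lra.
move=> v.
have : (gamma p S B Q v < (2 * T)%:E)%E.
  apply: le_lt_trans (_ : T%:E < _)%E; last by rewrite lte_fin; lra.
  by apply: le_trans supT; apply: ereal_sup_ubound; exists v.
move=> /gamma_lt[k [l [Qk _ yT]]]; exists k, l; split.
  exact/int_box_trunc.
by rewrite (le_trans (norm_le_lp_norm _ p_ge1))// ltW.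
Qed.

(** The factor 2 in the radius of [ae_separated] makes the bound strict, and
    [f j >= 2^m] makes this radius at most 1. *)
Lemma lt_inf_gamma : \forall B \ae lebesgue_mx R m n, \forall Q \near +oo,
  ((Q `^ (- m%:R^-1) * f (ln Q) `^ (- m%:R^-1))%:E
     < ereal_inf [set gamma p S B Q v | v in K B Q])%E.
Proof.
have [k0 k0_gt0 f_large] := f_unbounded f_gt0 f_mono f_sum (2 ^+ m).
have S1 : S `<=` unit_sphere R m by case: S_open => U _ -> y [].
apply: (ae_mono _ (ae_separated m_gt0 n_gt0 f_gt0 f_sum)) => B [j0 j0_gt0 Bj].
apply: (@near_pinfty_log _ _ (maxn j0 k0)).
move=> j Q; rewrite geq_max => /andP[j0j k0j] Q1 /andP[jQ Qj].
have Q0 : 0 < Q by lra.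
have j_gt0 : (0 < j)%N by exact: leq_trans j0j.
have jR : (0 : R) < j%:R by rewrite ltr0n.
have fj2 : 2 ^+ m <= f j%:R by rewrite f_large// ler_nat.
have fj0 := f_gt0 jR.
have t0 : 0 < expR (- j%:R / m%:R) * f j%:R `^ (- m%:R^-1).
  by rewrite mulr_gt0 ?expR_gt0 ?powR_gt0.
apply: (@lt_le_trans _ _ (2 * (expR (- j%:R / m%:R) * f j%:R `^ (- m%:R^-1)))%:E).
  rewrite lte_fin.
  apply: (@le_lt_trans _ _ (expR (- j%:R / m%:R) * f j%:R `^ (- m%:R^-1))); last first.
    by rewrite ltr_pMl//; lra.
  rewrite ler_pM ?expR_ge0 ?powR_ge0//.
    rewrite powR_expR// ler_expR mulNr mulNr lerN2 mulrC.
    by rewrite ler_pM2l ?invr_gt0 ?ltr0n.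
  rewrite !powRN lef_pV2 ?posrE ?powR_gt0 ?f_gt0//; last exact: lnQ_gt0 jQ.
  apply: ge0_ler_powR; rewrite ?nnegrE ?invr_ge0 ?(ltW (f_gt0 _))//.
    exact: lnQ_gt0 jQ.
  exact: f_mono.
apply: le_ereal_inf_tmp => _ [v Kv <-].
apply: (gamma_ge_separated p_ge1 S1 _ _ (Bj j j0j) Kv).
  have fj2' : 2 <= f j%:R `^ m%:R^-1.
    rewrite -(@ler_pXn2r _ m)// ?nnegrE ?powR_ge0//.
    by rewrite powR_invn_exprn// ltW.
  have ej : expR (- j%:R / m%:R) <= 1 :> R.
    by rewrite -expR0 ler_expR mulNr oppr_le0 divr_ge0.
  rewrite powRN mulrA ler_pdivrMr ?powR_gt0// mul1r (le_trans _ fj2')//; lra.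
by rewrite powR_expR// ler_expR mulrC ler_pM2r ?invr_gt0 ?ltr0n// ltW.
Qed.

(** Two points of [K B Q] lie within about [Q^(-1/m)] of each other. One of the
    two differences points into the cone, and they are nonzero for almost every
    [B] by separation. *)
Lemma inf_gamma_le : S `|` [set - u | u in S] = unit_sphere R m ->
  \forall B \ae lebesgue_mx R m n, \forall Q \near +oo,
  (ereal_inf [set gamma p S B Q v | v in K B Q]
     <= ((m + n).+1%:R * 2 * 4 ^+ (m + n) * Q `^ (- m%:R^-1))%:E)%E.
Proof.
move=> S_sym; pose d := (m + n)%N.
apply: (ae_mono _ (ae_separated m_gt0 n_gt0 f_gt0 f_sum)) => B [j0 j0_gt0 Bj].
apply: (@near_pinfty_log _ _ (maxn j0 (2 * d * m))).
move=> j Q; rewrite geq_max => /andP[j0j dj] Q1 /andP[jQ Qj].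
have Q0 : 0 < Q by lra.
have j_gt0 : (0 < j)%N by exact: leq_trans j0j.
have jR : (0 : R) < j%:R by rewrite ltr0n.
pose N := Num.trunc (Q `^ n%:R^-1); pose M := Num.trunc (Q `^ m%:R^-1 / 4 ^+ d).
(* [e^2 >= 4] and [ln Q >= 2 d m]. *)
have Qm_large : 4 ^+ d <= Q `^ m%:R^-1.
  have e2 : 2 <= expR 1 :> R by have := expR_ge1Dx (1 : R); lra.
  apply: (@le_trans _ _ (expR 1 ^+ (2 * d))).
    have e4 : 4 <= expR 1 ^+ 2 :> R.
      have : 0 <= (expR 1 - 2) * (expR 1 + 2) :> R by apply: mulr_ge0; lra.
      by rewrite expr2; lra.
    rewrite exprM; apply: lerXn2r; rewrite ?nnegrE; [by []| |exact: e4].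
    by rewrite exprn_ge0 ?expR_ge0.
  rewrite -expRM_natl mulr1 powR_expR// ler_expR mulrC ler_pdivlMr ?ltr0n//.
  by rewrite -natrM (le_trans _ jQ)// ler_nat.
have d4 : (0 : R) < 4 ^+ d by rewrite exprn_gt0.
have M_gt0 : (0 < M)%N by rewrite truncn_gt0 ler_pdivlMr// mul1r.
have M_le : M%:R <= Q `^ m%:R^-1 / 4 ^+ d.
  by rewrite truncn_le divr_ge0 ?powR_ge0 ?ltW.
have le_M : Q `^ m%:R^-1 / 4 ^+ d <= 2 * M%:R.
  have M1 : (1 : R) <= M%:R by rewrite ler1n.
  have := truncnS_gt (Q `^ m%:R^-1 / 4 ^+ d).
  by rewrite -/M -[M.+1%:R]natr1; lra.
have Qn1 : 1 <= Q `^ n%:R^-1.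
  by rewrite powR_expR// -expR0 ler_expR mulr_ge0 ?invr_ge0 ?ln_ge0.
have N_gt0 : (0 < N)%N by rewrite truncn_gt0.
have le_N : Q `^ n%:R^-1 <= 2 * N%:R.
  have N1 : (1 : R) <= N%:R by rewrite ler1n.
  by have := truncnS_gt (Q `^ n%:R^-1); rewrite -/N -[N.+1%:R]natr1; lra.
have MN : (M ^ m < N ^ n)%N.
  rewrite -(ltr_nat R) !natrX.
  apply: (@le_lt_trans _ _ (Q / (4 ^+ d) ^+ m)).
    rewrite -[Q in leRHS](powR_invn_exprn m_gt0 (ltW Q0)) -expr_div_n.
    by rewrite lerXn2r ?nnegrE ?divr_ge0 ?powR_ge0// ltW.
  apply: (@lt_le_trans _ _ (Q / 2 ^+ n)).
    rewrite ltr_pM2l// ltf_pV2 ?posrE ?exprn_gt0// -exprM -!natrX ltr_nat.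
    rewrite -[4%N]/(2 ^ 2)%N -expnM ltn_exp2l//.
    exact: lt_double_mul.
  rewrite ler_pdivrMr ?exprn_gt0// -exprMn mulrC.
  rewrite -[leLHS](powR_invn_exprn n_gt0 (ltW Q0)).
  by rewrite lerXn2r ?nnegrE ?powR_ge0 ?mulr_ge0.
have [k [k' [l [kk' kN kN' yM]]]] := pigeonhole_approx B M_gt0 MN.
have boxN (h : 'cV[int]_n) : (forall i, 0 < h i 0 <= N%:Z) -> int_box Q h.
  by move=> hN; apply/int_box_trunc.
move: yM; set y := _ + _ => yM.
have y0 : y != 0.
  apply/negP => /eqP y0; apply: (Bj j j0j); exists (k - k'), l; split.
  - by rewrite subr_eq0.
  - move=> i; rewrite !mxE.
    have := boxN _ kN i; have := boxN _ kN' i; rewrite intrB.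
    have : Q `^ n%:R^-1 <= expR (j.+1%:R / n%:R).
      by rewrite powR_expR// ler_expR mulrC ler_pM2r ?invr_gt0 ?ltr0n// ltW.
    rewrite ler_norml; lra.
  - by rewrite -/y y0 normr0 !mulr_ge0 ?expR_ge0 ?powR_ge0.
have normy : lp_norm p y <= d.+1%:R * 2 * 4 ^+ d * Q `^ (- m%:R^-1).
  apply: (le_trans (lp_norm_le_norm _ m_gt0 p_ge1)).
  rewrite -!mulrA; apply: ler_pM => //; first by rewrite ler_nat leqW// leq_addr.
  have M0 : (0 : R) < M%:R by rewrite ltr0n.
  have q0 : 0 < Q `^ m%:R^-1 by exact: powR_gt0.
  apply: (le_trans yM); rewrite powRN -[leLHS]mul1r ler_pdivrMr//.
  rewrite (_ : _ * M%:R = 2 * M%:R * 4 ^+ d / Q `^ m%:R^-1); last by ring.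
  by rewrite ler_pdivlMr// mul1r -ler_pdivrMr.
have : unit_sphere R m ((lp_norm 2%:E y)^-1 *: y) by exact: normalize_sphere.
have y2 := lp_norm2_gt0 y0.
have yE : y = lp_norm 2%:E y *: ((lp_norm 2%:E y)^-1 *: y).
  by rewrite scalerA mulfV ?gt_eqF// scale1r.
rewrite -S_sym => -[Su|[u Su uy]].
- apply: (@le_trans _ _ (gamma p S B Q (B *m map_mx intr k'))).
    apply: ereal_inf_lbound; exists (B *m map_mx intr k') => //.
    by exists k', 0; split; [exact: boxN|rewrite map_mx0 addr0].
  have ykl : B *m map_mx intr k + map_mx intr l - B *m map_mx intr k' = y.
    by rewrite /y map_mxB mulmxBr addrAC.
  apply: (@le_trans _ _ (lp_norm p y)%:E); last by rewrite lee_fin.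
  rewrite -ykl; apply: gamma_le; first exact: boxN.
  by rewrite ykl; exists (lp_norm 2%:E y), ((lp_norm 2%:E y)^-1 *: y).
- apply: (@le_trans _ _ (gamma p S B Q (B *m map_mx intr k))).
    apply: ereal_inf_lbound; exists (B *m map_mx intr k) => //.
    by exists k, 0; split; [exact: boxN|rewrite map_mx0 addr0].
  have ykl : B *m map_mx intr k' + map_mx intr (- l) - B *m map_mx intr k = - y.
    by rewrite /y map_mxB mulmxBr map_mxN opprD opprB addrAC.
  apply: (@le_trans _ _ (lp_norm p (- y))%:E); last by rewrite lp_normN lee_fin.
  rewrite -ykl; apply: gamma_le; first exact: boxN.
  rewrite ykl; exists (lp_norm 2%:E y), u; split=> //.
  by rewrite {1}yE -uy scalerN opprK.
Qed.

End Parts.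

Theorem theorem1p1 (R : realType) (d : nat) (p : \bar R) (hp : (1 <= p)%E) :
  exists2 C : R, 0 < C &
  forall (m n : nat) (S : set 'cV[R]_m) (f : R -> R),
    (0 < m)%N -> (0 < n)%N -> d = (m + n)%N ->
    S !=set0 -> open_in_sphere S ->
    (forall x, 0 < x -> 0 < f x) ->
    (forall x y, 0 < x -> x <= y -> f x <= f y) ->
    (\sum_(1 <= k <oo) ((f k%:R)^-1)%:E < +oo)%E ->
  (* (a) *)
  (\forall B \ae lebesgue_mx R m n, \forall Q \near +oo,
     (ereal_sup [set gamma p S B Q v | v in K B Q]
        <= ereal_sup [set gamma p S B Q v | v in [set: 'cV[R]_m]])%E /\
     (ereal_sup [set gamma p S B Q v | v in [set: 'cV[R]_m]]
        < (Q `^ (- m%:R^-1) * f (ln Q) `^ m%:R^-1)%:E)%E) /\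
  (* (b) *)
  (poly_growth f ->
   \forall B \ae lebesgue_mx R m n, \forall Q \near +oo,
     ((Q `^ (- m%:R^-1) * f (ln Q) `^ (- (m%:R ^+ 2)^-1))%:E
        < ereal_sup [set gamma p S B Q v | v in [set: 'cV[R]_m]])%E) /\
  (* (c) *)
  (poly_growth f ->
   (\forall B \ae lebesgue_mx R m n, \forall Q \near +oo,
     ((Q `^ (- m%:R^-1) * f (ln Q) `^ (- m%:R^-1))%:E
        < ereal_inf [set gamma p S B Q v | v in K B Q])%E) /\
   (S `|` [set - u | u in S] = unit_sphere R m ->
    \forall B \ae lebesgue_mx R m n, \forall Q \near +oo,
     (ereal_inf [set gamma p S B Q v | v in K B Q]
        <= (C * Q `^ (- m%:R^-1))%:E)%E)).
Proof.
exists (d.+1%:R * 2 * 4 ^+ d); first by rewrite mulr_gt0 ?mulr_gt0 ?exprn_gt0.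
move=> m n S f m0 n0 -> S0 S_open f0 f_mono f_sum; split.
  exact: sup_gamma_lt.
split=> [_|_]; first by apply: aeW => B; exact: lt_sup_gamma.
split; first exact: lt_inf_gamma.
exact: (inf_gamma_le hp m0 n0 f0 f_sum).
Qed.
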